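(* Let $p\ge2$, $n\in\mathbb{N}$, $k\in[n]$ and let $m\in\mathbb{N}$ satisfy $m\ge\sqrt{n/k}$. Then every measurable $f:\mathbb{T}^n\to\mathbb{C}$ satisfies $$\frac1{\binom nk}\sum_{\substack{\mathsf{S}\subset[n]\\|\mathsf{S}|=k}}\int_{\mathbb{T}^n}\int_{\mathbb{T}^n}\big|f(x+y_{\mathsf{S}})-f(x)\big|^p\,dy\,dx\ \le\ C_p\,m^p\int_{\mathbb{T}^n}\int_{\mathbb{T}^n}\Bigg\{\frac kn\sum_{j=1}^n\Big|f\Big(x+\frac{y_je_j}{4m}\Big)-f(x)\Big|^p+\Big(\frac kn\Big)^{\frac p2}\Big|f\Big(x+\frac{y}{4m}\Big)-f(x)\Big|^p\Bigg\}\,dy\,dx,$$ where $C_p$ depends only on $p$.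
   Context: $[n]=\{1,\dots,n\}$. The torus $\mathbb{T}^n$ is identified with $[-1/2,1/2)^n$ with addition modulo $1$ in each coordinate and Lebesgue (probability) measure. For $y\in\mathbb{T}^n$, the points $y/(4m)$ and $y_je_j/(4m)$ are computed using the representative $y\in[-1/2,1/2)^n$, where $e_j$ is the $j$-th standard basis vector. For $\mathsf{S}\subset[n]$, $y_{\mathsf{S}}=\sum_{j\in\mathsf{S}}y_je_j$. *)

(* Defs.v *)
From HB Require Import structures.
From mathcomp Require Import all_boot all_order all_algebra.
From mathcomp Require Import all_classical all_reals all_analysis.
From mathcomp Require Import complex.

Set Implicit Arguments.
Unset Strict Implicit.
Unset Printing Implicit Defensive.

Import Order.TTheory GRing.Theory Num.Theory.
Import numFieldNormedType.Exports.

Local Open Scope classical_set_scope.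
Local Open Scope ring_scope.

Section power_measure.
Context d (T : measurableType d) (R : realType).

Definition tuple_cons n (x : T * n.-tuple T) : n.+1.-tuple T :=
  [tuple of x.1 :: x.2].

Definition tuple_uncons n (x : n.+1.-tuple T) : T * n.-tuple T :=
  (thead x, [tuple of behead x]).

Lemma tuple_consK n : cancel (@tuple_cons n) (@tuple_uncons n).
Proof. by case=> x t; rewrite /tuple_uncons theadE; congr pair; exact/val_inj. Qed.

Lemma tuple_unconsK n : cancel (@tuple_uncons n) (@tuple_cons n).
Proof. by move=> x; rewrite [RHS]tuple_eta; exact/val_inj. Qed.

Lemma measurable_tuple_cons n : measurable_fun setT (@tuple_cons n).
Proof. exact: measurable_cons. Qed.

HB.instance Definition _ n :=
  @isMeasurableFun.Build _ _ _ _ (@tuple_cons n) (@measurable_tuple_cons n).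

Lemma measurable_tuple_uncons n : measurable_fun setT (@tuple_uncons n).
Proof.
by apply/measurable_fun_pair => /=; [exact: measurable_tnth|
  exact: measurable_behead].
Qed.

Variable mu : {sigma_finite_measure set T -> \bar R}.

Section step.
Context n (nu : {sigma_finite_measure set (n.-tuple T) -> \bar R}).

Definition cons_measure : set (n.+1.-tuple T) -> \bar R :=
  pushforward (mu \x nu)%E (@tuple_cons n).

Let cons_measure0 : cons_measure set0 = 0%E.
Proof. exact: measure0. Qed.

Let cons_measure_ge0 A : (0 <= cons_measure A)%E.
Proof. exact: measure_ge0. Qed.

Let cons_measure_sigma_additive : semi_sigma_additive cons_measure.
Proof.
exact: measure_semi_sigma_additive.
Qed.

HB.instance Definition _ := isMeasure.Build _ _ _ cons_measure
  cons_measure0 cons_measure_ge0 cons_measure_sigma_additive.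

Lemma cons_measure_sigma_finite : sigma_finite setT cons_measure.
Proof.
have /sigma_finiteP[F [TF ndF Foo]] := sigma_finiteT mu.
have /sigma_finiteP[G [TG ndG Goo]] := sigma_finiteT nu.
exists (fun i => @tuple_uncons n @^-1` (F i `*` G i)).
  rewrite -preimage_bigcup [X in _ @^-1` X](_ : _ = setT) ?preimage_setT//.
  rewrite -subTset => -[x y] _.
  have [i _ Fix] : (\bigcup_i F i) x by rewrite -TF.
  have [j _ Gjy] : (\bigcup_i G i) y by rewrite -TG.
  exists (maxn i j) => //; split=> /=.
    by move: x Fix; exact/subsetPset/ndF/leq_maxl.
  by move: y Gjy; exact/subsetPset/ndG/leq_maxr.
move=> i; have [mF Fi] := Foo i; have [mG Gi] := Goo i; split.
  rewrite -[X in measurable X]setTI.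
  by apply: measurable_tuple_uncons => //; exact: measurableX.
rewrite /cons_measure /pushforward -comp_preimage.
rewrite (_ : _ \o _ = id) ?preimage_id; last first.
  by apply/funext; exact: tuple_consK.
by rewrite product_measure1E// lte_mul_pinfty// ge0_fin_numE.
Qed.

HB.instance Definition _ :=
  Measure_isSigmaFinite.Build _ _ _ cons_measure cons_measure_sigma_finite.

End step.

(* the product measure of n copies of mu *)
Fixpoint power_measure n : {sigma_finite_measure set (n.-tuple T) -> \bar R} :=
  if n is n'.+1 then cons_measure (power_measure n')
  else dirac ([tuple] : 0.-tuple T).

End power_measure.

Section torus.
Context {R : realType}.

Local Notation borel_lebesgue := (power_measure (@lebesgue_measure R)).

(* R^n with its Lebesgue measurable (not only Borel) sets *)
Definition lebesgue_space n : measurableType _ :=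
  caratheodory_type (borel_lebesgue n)^*%mu.

Definition lebesgue_measure_tuple n : set (lebesgue_space n) -> \bar R :=
  @completed_measure_extension _ _ _ (borel_lebesgue n).
Arguments lebesgue_measure_tuple : clear implicits.

HB.instance Definition _ n := Measure.on (lebesgue_measure_tuple n).

(* the fundamental domain representing T^n; it has measure 1 *)
Definition torus n : set (n.-tuple R) :=
  [set x | forall i, - 2^-1 <= tnth x i < 2^-1].

(* representative in [-1/2, 1/2) of the class of t modulo 1 *)
Definition wrap (t : R) : R := t - (Num.floor (t + 2^-1))%:~R.

Definition torus_add n (x y : n.-tuple R) : n.-tuple R :=
  [tuple wrap (tnth x i + tnth y i) | i < n].

Definition tuple_scale n (c : R) (y : n.-tuple R) : n.-tuple R :=
  [tuple c * tnth y i | i < n].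

(* y_S *)
Definition tuple_restr n (S : {set 'I_n}) (y : n.-tuple R) : n.-tuple R :=
  [tuple if i \in S then tnth y i else 0 | i < n].

(* A function on T^n is a function on R^n whose values outside the fundamental
   domain are irrelevant *)
Definition torus_measurable n (f : n.-tuple R -> R[i]) : Prop :=
  measurable_fun (@torus n : set (lebesgue_space n)) (fun x => complex.Re (f x)) /\
  measurable_fun (@torus n : set (lebesgue_space n)) (fun x => complex.Im (f x)).

End torus.

Arguments lebesgue_measure_tuple {R} n _.
Arguments torus {R} n.

(* Main.v *)
(** For a function [h] on the sign cube and [S] a set of coordinates, let [g_S] be
    the conditional expectation of [h] given the coordinates in [S].  Adding a
    coordinate [j] to [S] adds to [g_S] an increment [d_j] that is odd in the
    sign [j], so the first-order term of [E |g_S + d_j|^p] cancels and only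
    [E |g_S|^(p-2) d_j^2] and [E |d_j|^p] remain.  Summing over [j], the former
    are at most [E |g_S|^(p-2) h^2] by Bessel's inequality (conditionally on [S],
    the [d_j] are orthogonal).  Young's inequality and a discrete Gronwall
    argument in the size of [S] then bound the average of [E |g_S - E h|^p] over
    the sets [S] of size [k] by
    [(k/n) sum_j E |h - h o flip_j|^p + (k/n)^(p/2) E |h - c|^p].

    On the torus, take [h e = f (x + 2 d (e y))] with [d = 1/(4m)].  Averaging [f]
    over the signs of the displacements [2 d y_i] with [i] outside [S] costs only
    increments of [f] along [d y], which [m^p (k/n)^(p/2) >= 1] absorbs.  The
    averaged function changes between [x] and [x + y_S] in [m] steps of length
    [4 d], and by translation and reflection invariance each of them is
    distributed as [g_S e - g_S (-e)]. *)
From HB Require Import structures.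
Require Import Defs.
From mathcomp Require Import all_boot all_order all_algebra.
From mathcomp Require Import all_classical all_reals all_analysis.
From mathcomp Require Import complex.
From mathcomp Require Import measurable_realfun ring lra zify.

Set Implicit Arguments.
Unset Strict Implicit.
Unset Printing Implicit Defensive.

Import Order.TTheory GRing.Theory Num.Theory.
Import numFieldNormedType.Exports.
Import Normc.

Local Open Scope ring_scope.

(** * Inequalities for real powers *)

Section powR_inequalities.
Context {R : realType}.
Implicit Types a b q p r t : R.

(** The right-hand side only offers displacements along one coordinate or along all of them, whereas
    the averaging outside [S] displaces the coordinates outside [S] alone. Such a displacement of
    size [2 d] is a sum of two full ones of size [d]: a sign vector, then the one that reverses it
    on [S] and repeats it elsewhere. Reflection invariance in [y] makes both as cheap as [d y]. This
    is why the cube samples [f] at distance [2 d]; antipodal samples are then [4 d] apart, and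
    [4 m d = 1] lets [m] such steps make up [y_S].

    A second difficulty is measure theoretic. As [f] is only Lebesgue measurable, its increments
    need not be measurable for the product Borel structure in which Tonelli and the translations
    operate. The real and imaginary parts of [f] are replaced by Borel functions that agree with
    them off a Borel null set, and translation invariance shows that the displaced points avoid this
    set for almost every [x] and then almost every [y]. *)

Lemma powR_tangent q a b : 1 <= q -> 0 <= a -> 0 <= b ->
  a `^ q - b `^ q <= q * a `^ (q - 1) * (a - b).
Proof.
move=> q1 a0 b0; have q0 : 0 < q by lra.
(* Convexity of the power is obtained from Young's inequality for [b] and [a^(q-1)] with exponents
   [q] and [q/(q-1)]; the second one is infinite for [q = 1]. *)
have [->|qn1] := eqVneq q 1; first by rewrite subrr powRr0 !powRr1//; lra.
have q10 : 0 < q - 1 by rewrite subr_gt0 lt_neqAle eq_sym qn1.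
have := @conjugate_powR _ b (a `^ (q - 1)) q (q / (q - 1)) b0 (powR_ge0 _ _) q0.
rewrite -powRrM mulrCA divff ?gt_eqF// mulr1 divr_gt0// invf_div => /(_ erefl).
have -> : q^-1 + (q - 1) / q = 1 by field; rewrite gt_eqF.
move=> /(_ erefl) young.
have aq : a * a `^ (q - 1) = a `^ q by rewrite mulr_powRB1.
rewrite mulrBr -!mulrA [_ * a]mulrC aq [_ * b]mulrC.
suff : q * (b * a `^ (q - 1)) <= b `^ q + (q - 1) * a `^ q by lra.
rewrite -(ler_pM2l q0) in young; apply: (le_trans young).
by rewrite le_eqVlt; apply/orP; left; apply/eqP; field; rewrite !gt_eqF.
Qed.

Lemma powR_sqr a p : 2 <= p -> 0 <= a -> a `^ (p - 2) * a ^+ 2 = a `^ p.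
Proof.
move=> p2 a0; have [->|an0] := eqVneq a 0.
  by rewrite expr0n mulr0 powR0//; lra.
rewrite -powR_mulrn// -powRD; last by rewrite an0 implybT.
by rewrite subrK.
Qed.

Lemma sqr_powR a r : 0 <= a -> (a ^+ 2) `^ (r / 2) = a `^ r.
Proof. by move=> a0; rewrite -powR_mulrn// -powRrM mulrC divfK. Qed.

Lemma powR_sum_le (I : finType) (x : I -> R) p : 1 <= p ->
  `|\sum_i x i| `^ p <= #|I|%:R `^ (p - 1) * \sum_i `|x i| `^ p.
Proof.
move=> p1; have [I0|I0] := posnP #|I|.
  rewrite [X in `|X|]big1; last by move=> i _; have := fintype0 i I0.
  rewrite normr0 powR0; last by rewrite gt_eqF//; lra.
  by rewrite mulr_ge0 ?powR_ge0// sumr_ge0// => i _; exact: powR_ge0.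
set N : R := #|I|%:R; have N0 : 0 < N by rewrite ltr0n.
set s := \sum_i `|x i|; have s0 : 0 <= s by rewrite sumr_ge0.
apply: (@le_trans _ _ (s `^ p)).
  by apply: ge0_ler_powR; rewrite ?nnegrE// ?ler_norm_sum// (le_trans ler01).
set a := s / N; have a0 : 0 <= a by rewrite divr_ge0// ltW.
(* Tangent inequalities at the mean [a]: their linear parts add up to zero. *)
have h : \sum_i (a `^ p - `|x i| `^ p) <= \sum_i p * a `^ (p - 1) * (a - `|x i|).
  by apply: ler_sum => i _; exact: powR_tangent.
move: h; rewrite -mulr_sumr !sumrB !sumr_const -[_ *+ _]mulr_natr -/N.
rewrite -[a *+ _]mulr_natr -/N -/s divfK ?gt_eqF// subrr mulr0 subr_le0 => h.
have -> : s = a * N by rewrite divfK// gt_eqF.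
rewrite powRM//.
rewrite -[N `^ p](mulr_powRB1 (ltW N0)); last by lra.
by rewrite mulrA [leLHS]mulrC ler_wpM2l// powR_ge0.
Qed.

Lemma powR_mean_le (I : finType) (x : I -> R) p : 1 <= p ->
  `|#|I|%:R^-1 * \sum_i x i| `^ p <= #|I|%:R^-1 * \sum_i `|x i| `^ p.
Proof.
move=> p1; have [I0|I0] := posnP #|I|.
  by rewrite I0 invr0 !mul0r normr0 powR0// gt_eqF//; lra.
have N0 : (0 : R) < #|I|%:R by rewrite ltr0n.
rewrite normrM powRM// ger0_norm ?invr_ge0 ?ler0n//.
apply: le_trans (ler_wpM2l (powR_ge0 _ _) (powR_sum_le x p1)) _.
rewrite mulrA ler_wpM2r ?sumr_ge0//.
rewrite -!powR_inv1 ?ler0n// -powRrM -powRD; last by rewrite (gt_eqF N0) implybT.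
by rewrite (_ : -1 * p + _ = -1)//; lra.
Qed.

Lemma powR_add_le a b p : 1 <= p ->
  `|a + b| `^ p <= 2 `^ (p - 1) * (`|a| `^ p + `|b| `^ p).
Proof.
move=> p1; have := @powR_sum_le bool (fun i => if i then a else b) p p1.
by rewrite !big_bool card_bool.
Qed.

(** One summand for each regime of [two_point]: the first for [|b| <= |a|], the second for
    [|a| < |b|], where [|a + b|] and [|a - b|] are at most [2 |b|]. *)
Definition two_point_const p : R := p * (p - 1) * 2 `^ (p - 2) + 2 `^ p.

Lemma two_point_const_gt0 p : 2 <= p -> 0 < two_point_const p.
Proof.
move=> p2; rewrite ltr_wpDl ?powR_gt0//.
by rewrite mulr_ge0 ?powR_ge0// mulr_ge0; lra.
Qed.

(* The first-order terms cancel, so only the second-order bound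
   [p (p - 1) (2 a)^(p - 2) b^2] survives when [b <= a]. *)
Lemma two_point a b p : 2 <= p ->
  (`|a + b| `^ p + `|a - b| `^ p) / 2 <=
  `|a| `^ p + two_point_const p * (`|a| `^ (p - 2) * b ^+ 2 + `|b| `^ p).
Proof.
move=> p2.
wlog a0 : a b / 0 <= a.
  move=> h; have [/h//|a0] := leP 0 a.
  have /(h (- a) (- b)) : 0 <= - a by rewrite oppr_ge0 ltW.
  by rewrite -!opprD !normrN sqrrN.
wlog b0 : b / 0 <= b.
  move=> h; have [/h//|b0] := leP 0 b.
  have /h : 0 <= - b by rewrite oppr_ge0 ltW.
  by rewrite opprK sqrrN normrN [X in X / 2]addrC.
have t1 : 0 <= p * (p - 1) * 2 `^ (p - 2) * (a `^ (p - 2) * b ^+ 2).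
  rewrite mulr_ge0 ?mulr_ge0 ?powR_ge0 ?sqr_ge0//; lra.
have t2 : 0 <= 2 `^ p * (a `^ (p - 2) * b ^+ 2).
  by rewrite !mulr_ge0 ?powR_ge0 ?sqr_ge0.
have t3 : 0 <= p * (p - 1) * 2 `^ (p - 2) * b `^ p.
  rewrite mulr_ge0 ?mulr_ge0 ?powR_ge0//; lra.
have t4 : 0 <= 2 `^ p * b `^ p by rewrite mulr_ge0 ?powR_ge0.
have t5 : 0 <= a `^ p by rewrite powR_ge0.
rewrite !(ger0_norm a0) !(ger0_norm b0) /two_point_const.
have [ba|ab] := leP b a.
  rewrite !ger0_norm; [|lra..].
  (* The tangent inequalities at [a + b] and [a - b] leave [p b] times the difference of the slopes.
     A third one, with exponent [p - 1 >= 1], bounds that difference by a multiple of [b]. *)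
  have := @powR_tangent p (a + b) a ltac:(lra) ltac:(lra) a0.
  have := @powR_tangent p (a - b) a ltac:(lra) ltac:(lra) a0.
  have := @powR_tangent (p - 1) (a + b) (a - b) ltac:(lra) ltac:(lra) ltac:(lra).
  rewrite -!addrA -opprD.
  have -> : (a + b) `^ (p - (1 + 1)) = (a + b) `^ (p - 2) by [].
  have : (a + b) `^ (p - 2) <= 2 `^ (p - 2) * a `^ (p - 2).
    rewrite -powRM//; apply: ge0_ler_powR; rewrite ?nnegrE; lra.
  set u := (a + b) `^ (p - 2); set u' := 2 `^ _ * a `^ _.
  set v := (a + b) `^ (p - 1); set w := (a - b) `^ (p - 1).
  move=> uu h1 h2 h3.
  have : p * b * (v - w) <= p * b * ((p - 1) * u' * (2 * b)).
    rewrite ler_wpM2l//; first by rewrite mulr_ge0//; lra.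
    apply: le_trans h1 _; rewrite (_ : a + (b + - (a - b)) = 2 * b); last by lra.
    by rewrite ler_wpM2r ?mulr_ge0// ler_wpM2l//; lra.
  move=> h4.
  have e : p * (p - 1) * 2 `^ (p - 2) * (a `^ (p - 2) * b ^+ 2) =
      (p * b * ((p - 1) * u' * (2 * b))) / 2 by rewrite /u'; field.
  rewrite e in t1; lra.
have h (x : R) : `|x| <= 2 * b -> `|x| `^ p <= 2 `^ p * b `^ p.
  by move=> xb; rewrite -powRM//; apply: ge0_ler_powR; rewrite ?nnegrE//; lra.
have := h (a + b); rewrite ger0_norm; last lra.
move=> /(_ ltac:(lra)) h1.
have := h (a - b); rewrite ler0_norm; last lra.
by move=> /(_ ltac:(lra)) h2; lra.
Qed.

(** Either [b^2 <= t a^2] and the first term suffices, or [a^2 < b^2 / t] and the power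
    [(p - 2) / 2] of this gives the second. The free parameter [t] becomes [n / k] in the Gronwall
    argument. *)
Lemma powR_young a b t p : 2 <= p -> 0 <= a -> 0 <= b -> 0 < t ->
  a `^ (p - 2) * b ^+ 2 <= t * a `^ p + t `^ (1 - p / 2) * b `^ p.
Proof.
move=> p2 a0 b0 t0; have [h|h] := leP (b ^+ 2) (t * a ^+ 2).
  apply: (@le_trans _ _ (t * a `^ p)); last first.
    by rewrite lerDl mulr_ge0// powR_ge0.
  by rewrite -(powR_sqr p2 a0) [leRHS]mulrCA ler_wpM2l// powR_ge0.
apply: (@le_trans _ _ (t `^ (1 - p / 2) * b `^ p)); last first.
  by rewrite lerDr mulr_ge0 ?powR_ge0// ltW.
rewrite -(powR_sqr p2 b0) mulrA ler_wpM2r ?sqr_ge0//.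
rewrite -(sqr_powR (p - 2) a0) -(sqr_powR (p - 2) b0).
have -> : 1 - p / 2 = - ((p - 2) / 2) by field.
rewrite powRN [leRHS]mulrC ler_pdivlMr ?powR_gt0// mulrC -powRM ?sqr_ge0 ?(ltW t0)//.
apply: ge0_ler_powR; [lra| |by rewrite nnegrE sqr_ge0|exact: ltW].
by rewrite nnegrE mulr_ge0 ?sqr_ge0 ?(ltW t0).
Qed.

End powR_inequalities.

(** * Conditional expectations on the sign cube *)

Definition avg {R : realType} {T : finType} (F : T -> R) : R :=
  #|T|%:R^-1 * \sum_t F t.

Section avg.
Context {R : realType} {T : finType}.
Implicit Types (F G : T -> R) (c p : R).

Lemma avgD F G : avg (fun t => F t + G t) = avg F + avg G.
Proof. by rewrite /avg big_split mulrDr. Qed.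

Lemma avgZ c F : avg (fun t => c * F t) = c * avg F.
Proof. by rewrite /avg -mulr_sumr mulrCA. Qed.

Lemma avgN F : avg (fun t => - F t) = - avg F.
Proof. by rewrite /avg sumrN mulrN. Qed.

Lemma avgB F G : avg (fun t => F t - G t) = avg F - avg G.
Proof. by rewrite avgD avgN. Qed.

Lemma avg_sum (I : Type) (r : seq I) (P : pred I) (F : I -> T -> R) :
  avg (fun t => \sum_(i <- r | P i) F i t) = \sum_(i <- r | P i) avg (F i).
Proof. by rewrite /avg exchange_big -mulr_sumr. Qed.

Lemma avg_cst c : (0 < #|T|)%N -> avg (fun _ : T => c) = c.
Proof.
move=> T0; have T0' : (#|T|%:R : R) != 0 by rewrite pnatr_eq0 -lt0n.
by rewrite /avg sumr_const -[c *+ _]mulr_natl mulrA mulVf ?mul1r.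
Qed.

Lemma avg_ge0 F : (forall t, 0 <= F t) -> 0 <= avg F.
Proof. by move=> F0; rewrite mulr_ge0 ?invr_ge0 ?ler0n ?sumr_ge0. Qed.

Lemma le_avg F G : (forall t, F t <= G t) -> avg F <= avg G.
Proof.
by move=> FG; rewrite ler_wpM2l ?invr_ge0 ?ler0n//; exact: ler_sum.
Qed.

Lemma eq_avg F G : (forall t, F t = G t) -> avg F = avg G.
Proof. by move=> FG; congr avg; exact/funext. Qed.

Lemma avg_reindex (h : T -> T) F : injective h -> avg (F \o h) = avg F.
Proof. by move=> hi; rewrite /avg [in RHS](reindex_inj hi). Qed.

Lemma avg_powR F p : 1 <= p -> `|avg F| `^ p <= avg (fun t => `|F t| `^ p).
Proof. exact: powR_mean_le. Qed.

End avg.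

Notation cube n := {ffun 'I_n -> bool}.

Section cube_operations.
Context {n : nat}.
Implicit Types (S : {set 'I_n}) (e f : cube n) (j : 'I_n).

Definition splice S e f : cube n := [ffun i => if i \in S then e i else f i].

Definition flip j e : cube n := [ffun i => if i == j then ~~ e i else e i].

Lemma card_cube : #|{: cube n}| = (2 ^ n)%N.
Proof. by rewrite card_ffun card_bool card_ord. Qed.

Lemma card_cube_gt0 : (0 < #|{: cube n}|)%N.
Proof. by rewrite card_cube expn_gt0. Qed.

Lemma flipK j : involutive (flip j).
Proof.
by move=> e; apply/ffunP => i; rewrite !ffunE; case: eqP => // _; rewrite negbK.
Qed.

Lemma flip_inj j : injective (flip j).
Proof. exact/can_inj/flipK. Qed.

Lemma spliceA S e f g : splice S (splice S e f) g = splice S e g.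
Proof. by apply/ffunP => i; rewrite !ffunE; case: (i \in S). Qed.

Lemma splice_subset S S' e f g : S \subset S' ->
  splice S (splice S' e f) g = splice S e g.
Proof.
move=> /fintype.subsetP SS'; apply/ffunP => i; rewrite !ffunE.
by case: (boolP (i \in S)) => // /SS' ->.
Qed.

Lemma splice_flip_in S e f j : j \in S -> splice S (flip j e) f = flip j (splice S e f).
Proof.
by move=> jS; apply/ffunP => i; rewrite !ffunE; case: (eqVneq i j) => [->|//]; rewrite jS.
Qed.

Lemma splice_flip_notin S e f j : j \notin S -> splice S (flip j e) f = splice S e f.
Proof.
move=> jS; apply/ffunP => i; rewrite !ffunE; case: (eqVneq i j) => [->|//].
by rewrite (negbTE jS).
Qed.

End cube_operations.

Section conditional_expectation.
Context {R : realType} {n : nat}.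
Implicit Types (S : {set 'I_n}) (e f : cube n) (j : 'I_n) (h u w : cube n -> R).

(** Exchanging the coordinates outside [S] between two points is an involution on pairs, hence
    preserves the uniform measure. *)
Lemma avg_splice S (F : cube n -> cube n -> R) :
  avg (fun e => avg (fun f => F (splice S e f) (splice S f e))) =
  avg (fun e => avg (F e)).
Proof.
rewrite /avg -!mulr_sumr; congr (_ * (_ * _)); rewrite !pair_bigA /=.
pose s (ef : cube n * cube n) := (splice S ef.1 ef.2, splice S ef.2 ef.1).
have sK : involutive s.
  move=> [e f]; rewrite /s /=; congr pair; apply/ffunP => i; rewrite !ffunE;
  by case: (i \in S).
by rewrite [in RHS](reindex_inj (can_inj sK)).
Qed.

Lemma avg_splice1 S h : avg (fun e => avg (fun f => h (splice S e f))) = avg h.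
Proof.
rewrite (avg_splice S (fun e _ => h e)).
by apply: eq_avg => e; rewrite avg_cst// card_cube_gt0.
Qed.

(** The coordinates of [f] in [S] are discarded by [splice], so that for every [S] the average runs
    over the same full cube with the same normalization. *)
Definition cond S h e : R := avg (fun f => h (splice S e f)).

Definition depends_on S h := forall e f, h (splice S e f) = h e.

Lemma cond_depends S h : depends_on S (cond S h).
Proof. by move=> e f; apply: eq_avg => g; rewrite spliceA. Qed.

Lemma depends_subset S S' h : S \subset S' -> depends_on S h -> depends_on S' h.
Proof. by move=> SS' hS e f; rewrite -(hS _ e) splice_subset// hS. Qed.

Lemma dependsM S h u : depends_on S h -> depends_on S u ->
  depends_on S (fun e => h e * u e).
Proof. by move=> hS uS e f; rewrite hS uS. Qed.

Lemma depends_flip S h e j : depends_on S h -> j \notin S -> h (flip j e) = h e.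
Proof. by move=> hS jS; rewrite -(hS _ e) splice_flip_notin// hS. Qed.

Lemma avg_mul_cond S u h : depends_on S u ->
  avg (fun e => u e * cond S h e) = avg (fun e => u e * h e).
Proof.
move=> uS; rewrite -[RHS](avg_splice1 S); apply: eq_avg => e.
by rewrite -avgZ; apply: eq_avg => f; rewrite uS.
Qed.

Lemma cond0 h e : cond finset.set0 h e = avg h.
Proof.
by apply: eq_avg => f; congr h; apply/ffunP => i; rewrite ffunE inE.
Qed.

Lemma avg_powR_cond S h p : 1 <= p ->
  avg (fun e => `|cond S h e| `^ p) <= avg (fun e => `|h e| `^ p).
Proof.
move=> p1; rewrite -[leRHS](avg_splice1 S).
by apply: le_avg => e; exact: avg_powR.
Qed.

Section increment.
Variables (S : {set 'I_n}) (j : 'I_n) (jS : j \notin S) (h : cube n -> R).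

Definition incr e := cond (j |: S) h e - cond S h e.

Lemma cond_flip e : cond S h (flip j e) = cond S h e.
Proof. exact: depends_flip (cond_depends _ _) jS. Qed.

Lemma cond_setU1 e :
  cond S h e = (cond (j |: S) h e + cond (j |: S) h (flip j e)) / 2.
Proof.
apply: (@mulIf _ 2) => //; rewrite divfK//.
(* Pair [f] with [flip j f]: exactly one of the two agrees with [e] in coordinate [j]. *)
rewrite /cond mulr_natr mulr2n -{2}(avg_reindex _ (@flip_inj _ j)) -!avgD.
apply: eq_avg => f /=.
have [ef|ef] := eqVneq (f j) (e j).
  congr (h _ + h _); apply/ffunP => i; rewrite !ffunE !inE;
    by case: (eqVneq i j) => [->|//]; rewrite (negbTE jS) ef.
rewrite addrC; congr (h _ + h _); apply/ffunP => i; rewrite !ffunE !inE;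
  case: (eqVneq i j) => [->|//]; rewrite (negbTE jS); move: ef;
  by case: (f j); case: (e j).
Qed.

Lemma cond_setU1_incr e : cond (j |: S) h e = cond S h e + incr e.
Proof. by rewrite addrC subrK. Qed.

Lemma incrE e : incr e = (cond (j |: S) h e - cond (j |: S) h (flip j e)) / 2.
Proof. by rewrite /incr cond_setU1; field. Qed.

Lemma incr_flip e : incr (flip j e) = - incr e.
Proof. by rewrite !incrE flipK; field. Qed.

Lemma incr_depends : depends_on (j |: S) incr.
Proof.
move=> e f; rewrite /incr cond_depends; congr (_ - _).
by apply: depends_subset (cond_depends _ _) _ _; exact: finset.subsetUr.
Qed.

Lemma avg_incr_odd u : (forall e, u (flip j e) = u e) ->
  avg (fun e => u e * incr e) = 0.
Proof.
move=> uj; have : avg (fun e => u e * incr e) = - avg (fun e => u e * incr e).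
  rewrite -{1}(avg_reindex _ (@flip_inj _ j)) -avgN; apply: eq_avg => e /=.
  by rewrite uj incr_flip mulrN.
by move=> ?; lra.
Qed.

(** The factor [w * incr] depends on [j |: S] only, so [h] may be replaced by its conditional
    expectation [cond S h + incr]; the part [cond S h] drops out by oddness. *)
Lemma avg_mul_incr w : depends_on S w ->
  avg (fun e => w e * incr e * h e) = avg (fun e => w e * incr e ^+ 2).
Proof.
move=> wS; have wjS := depends_subset (finset.subsetUr [set j] S) wS.
rewrite -(avg_mul_cond _ (dependsM wjS incr_depends)).
rewrite (eq_avg (G := fun e => w e * cond S h e * incr e + w e * incr e ^+ 2)).
  rewrite avgD avg_incr_odd ?add0r// => e.
  by rewrite cond_flip (depends_flip _ wS jS).
by move=> e; rewrite cond_setU1_incr; ring.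
Qed.

(** [incr] is itself a conditional expectation, namely of half the discrete derivative of [h] in
    direction [j], and [cond] is a contraction for the [p]-norm. *)
Lemma avg_powR_incr p : 1 <= p ->
  avg (fun e => `|incr e| `^ p) <=
  avg (fun e => `|(h e - h (flip j e)) / 2| `^ p).
Proof.
move=> p1; apply: le_trans (avg_powR_cond (j |: S) _ p1).
apply: le_avg => e; rewrite le_eqVlt; apply/orP; left; apply/eqP.
congr (`|_| `^ p); rewrite incrE /cond -avgB mulrC -avgZ; apply: eq_avg => f.
by rewrite mulrC splice_flip_in// setU11.
Qed.

Lemma avg_powR_cond_setU1 p : 2 <= p ->
  avg (fun e => `|cond (j |: S) h e| `^ p) <=
  avg (fun e => `|cond S h e| `^ p) + two_point_const p *
   (avg (fun e => `|cond S h e| `^ (p - 2) * incr e ^+ 2)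
    + avg (fun e => `|(h e - h (flip j e)) / 2| `^ p)).
Proof.
move=> p2.
apply: (@le_trans _ _ (avg (fun e => `|cond S h e| `^ p) + two_point_const p *
   (avg (fun e => `|cond S h e| `^ (p - 2) * incr e ^+ 2)
    + avg (fun e => `|incr e| `^ p)))); last first.
  rewrite lerD2l ler_wpM2l ?(ltW (two_point_const_gt0 p2))// lerD2l.
  by apply: avg_powR_incr; lra.
rewrite -avgD -avgZ -avgD.
(* Averaging over the sign [j] fixes [cond S h] and negates [incr], which creates the symmetric form
   required by [two_point]. *)
have -> : avg (fun e => `|cond (j |: S) h e| `^ p) =
    avg (fun e => (`|cond S h e + incr e| `^ p + `|cond S h e - incr e| `^ p) / 2).
  under [RHS]eq_avg do rewrite mulrC.
  rewrite avgZ avgD -[X in _ * (_ + X)](avg_reindex _ (@flip_inj _ j)).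
  rewrite -avgD -avgZ; apply: eq_avg => e /=.
  by rewrite cond_flip incr_flip opprK -cond_setU1_incr; field.
by apply: le_avg => e; exact: two_point.
Qed.

End increment.

Lemma bessel_incr S h w : depends_on S w -> (forall e, 0 <= w e) ->
  \sum_(j | j \notin S) avg (fun e => w e * incr S j h e ^+ 2) <=
  avg (fun e => w e * h e ^+ 2).
Proof.
move=> wS w0; set B := \sum_(j | _) _.
pose D e := \sum_(j | j \notin S) incr S j h e.
have wD2 : avg (fun e => w e * D e ^+ 2) = B.
  under eq_avg do rewrite expr2 mulrA /D mulr_sumr.
  rewrite avg_sum; apply: eq_bigr => j jS.
  under eq_avg do rewrite mulr_sumr mulr_suml.
  rewrite avg_sum (bigD1 j)//= big1 ?addr0; last first.
    (* For [i] other than [j], the increment in direction [i] does not see the sign [j], so the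
       cross term is the average of an odd function. *)
    move=> i /andP[iS ij]; apply: avg_incr_odd => // e.
    rewrite (depends_flip _ wS jS); congr (_ * _).
    by apply: depends_flip (incr_depends _ _ _) _; rewrite !inE negb_or eq_sym ij.
  by apply: eq_avg => e; rewrite expr2 mulrA.
have whD : avg (fun e => w e * D e * h e) = B.
  under eq_avg do rewrite /D mulr_sumr mulr_suml.
  by rewrite avg_sum; apply: eq_bigr => j jS; rewrite avg_mul_incr.
(* Both [E w D h] and [E w D^2] equal [B], so expanding this square leaves [E w h^2 - B]. *)
have : 0 <= avg (fun e => w e * (h e - D e) ^+ 2).
  by apply: avg_ge0 => e; rewrite mulr_ge0 ?sqr_ge0.
rewrite (eq_avg (G := fun e => w e * h e ^+ 2 -
    (2 * (w e * D e * h e) - w e * D e ^+ 2))); last by move=> e; ring.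
by rewrite avgB avgB avgZ wD2 whD; lra.
Qed.

End conditional_expectation.

(** * Averages over coordinate sets of a given size *)

Section level_averages.
Context {R : realType} {n : nat}.
Implicit Types (S T : {set 'I_n}) (phi : {set 'I_n} -> R) (d : 'I_n -> R).

(** Double counting of pairs [j \in T]: a set [T] of size [i + 1] arises once from each [T :\ j]. *)
Lemma sum_level_up phi i :
  \sum_(S : {set 'I_n} | #|S| == i) \sum_(j | j \notin S) phi (j |: S) =
  i.+1%:R * \sum_(S : {set 'I_n} | #|S| == i.+1) phi S.
Proof.
rewrite mulr_sumr.
transitivity (\sum_(T : {set 'I_n} | #|T| == i.+1) \sum_(j in T) phi T); last first.
  by apply: eq_bigr => T /eqP iT; rewrite sumr_const iT mulr_natl.
rewrite (exchange_big_dep xpredT)//= [RHS](exchange_big_dep xpredT)//=.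
apply: eq_bigr => j _.
rewrite [RHS](reindex_onto (fun S => j |: S) (fun T => T :\ j))/=; last first.
  by move=> T /andP[_ jT]; rewrite finset.setD1K.
apply: eq_bigl => S; rewrite finset.setU11 andbT.
have [jS|jS] := boolP (j \in S); rewrite ?andbF ?andbT.
  apply/esym/negbTE; rewrite negb_and orbC; apply/orP; left.
  by apply: contraTN jS => /eqP <-; rewrite finset.setD11.
by rewrite cardsU1 jS add1n eqSS finset.setU1K// eqxx andbT.
Qed.

Lemma sum_level_notin d i :
  \sum_(S : {set 'I_n} | #|S| == i) \sum_(j | j \notin S) d j =
  'C(n.-1, i)%:R * \sum_j d j.
Proof.
rewrite (exchange_big_dep xpredT)//= mulr_sumr; apply: eq_bigr => j _.
rewrite sumr_const mulr_natl; congr (_ *+ _).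
rewrite -[n.-1](_ : #|~: [set j]| = _)%N; last by rewrite cardsC1 card_ord.
rewrite -cards_draws; apply: eq_card => S.
by rewrite !inE unfold_in/= finset.subsetC finset.sub1set inE andbC.
Qed.

Definition level_avg phi i : R :=
  'C(n, i)%:R^-1 * \sum_(S : {set 'I_n} | #|S| == i) phi S.

Lemma level_avg_le phi psi i : (forall S, phi S <= psi S) ->
  level_avg phi i <= level_avg psi i.
Proof.
by move=> h; rewrite ler_wpM2l ?invr_ge0 ?ler0n//; apply: ler_sum => S _.
Qed.

Lemma level_avg_ge0 phi i : (forall S, 0 <= phi S) -> 0 <= level_avg phi i.
Proof. by move=> h; rewrite mulr_ge0 ?invr_ge0 ?ler0n ?sumr_ge0. Qed.

Lemma level_avg_cst (c : R) i : (i <= n)%N -> level_avg (fun=> c) i = c.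
Proof.
move=> ni; rewrite /level_avg sumr_const -[c *+ _]mulr_natl mulrA.
rewrite (_ : #|_| = 'C(n, i)) ?mulVf ?mul1r//.
  by rewrite pnatr_eq0 -lt0n bin_gt0.
by rewrite -[n in RHS]card_ord -card_draws; apply: eq_card => S; rewrite !inE.
Qed.

(** The hypothesis is summed over the sets of size [i] and divided by [(n - i) C(n, i)], which
    equals both [(i + 1) C(n, i + 1)] and [n C(n - 1, i)]. The second form is why the sum of [d] is
    divided by [n] whatever the level: each [j] is missed by [C(n - 1, i)] sets. *)
Lemma level_avg_up phi (lambda mu : R) d i : (i < n)%N ->
  (forall S, #|S| = i -> \sum_(j | j \notin S) phi (j |: S) <=
     ((n - i)%:R + lambda) * phi S + mu + \sum_(j | j \notin S) d j) ->
  level_avg phi i.+1 <= (1 + lambda / (n - i)%:R) * level_avg phi i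
     + mu / (n - i)%:R + (\sum_j d j) / n%:R.
Proof.
move=> ltin h.
have N0 : (0 : R) < (n - i)%:R by rewrite ltr0n subn_gt0.
have C0 : (0 : R) < 'C(n, i)%:R by rewrite ltr0n bin_gt0 ltnW.
have n0 : (0 : R) < n%:R by rewrite ltr0n (leq_ltn_trans _ ltin).
have C1 : i.+1%:R * 'C(n, i.+1)%:R = (n - i)%:R * 'C(n, i)%:R :> R.
  by rewrite -!natrM mul_bin_left.
have C2 : n%:R * 'C(n.-1, i)%:R = (n - i)%:R * 'C(n, i)%:R :> R.
  by rewrite -!natrM mul_bin_diag mul_bin_left.
have C1' : 'C(n, i.+1)%:R = (n - i)%:R * 'C(n, i)%:R / i.+1%:R :> R.
  by rewrite -C1 mulrC mulKf// pnatr_eq0.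
have C2' : 'C(n.-1, i)%:R = (n - i)%:R * 'C(n, i)%:R / n%:R :> R.
  by rewrite -C2 mulrC mulKf// gt_eqF.
have I0 : (0 : R) < i.+1%:R by rewrite ltr0n.
have : \sum_(S : {set 'I_n} | #|S| == i) \sum_(j | j \notin S) phi (j |: S) <=
   \sum_(S : {set 'I_n} | #|S| == i) (((n - i)%:R + lambda) * phi S + mu
     + \sum_(j | j \notin S) d j).
  by apply: ler_sum => S /eqP; exact: h.
rewrite sum_level_up; move: (i.+1%:R : R) I0 C1' {C1} => I I0 C1'.
rewrite !big_split/= -mulr_sumr sum_level_notin.
have := level_avg_cst mu (ltnW ltin); rewrite /level_avg.
move=> /(canRL (mulKf (invr_neq0 (lt0r_neq0 C0)))); rewrite invrK => ->.
set X := \sum_(S : {set _} | _) _; set Y := \sum_(S : {set _} | _) _.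
move=> hX; rewrite C1' -(ler_pM2l N0) -(ler_pM2l C0).
have -> : 'C(n, i)%:R * ((n - i)%:R * (((n - i)%:R * 'C(n, i)%:R / I)^-1 * X))
   = I * X by field; rewrite !gt_eqF.
apply: le_trans hX _; rewrite C2' le_eqVlt; apply/orP; left; apply/eqP.
by field; rewrite !gt_eqF.
Qed.

End level_averages.

(** * A discrete Gronwall inequality *)

Section gronwall.
Context {R : realType}.

Lemma discrete_gronwall (u : nat -> R) (a b : R) k : 0 <= a -> 0 <= b ->
  u 0 = 0 -> (forall i, (i < k)%N -> u i.+1 <= (1 + a) * u i + b) ->
  u k <= k%:R * b * expR (k%:R * a).
Proof.
move=> a0 b0 u0 ih.
suff h i : (i <= k)%N -> u i <= i%:R * b * (1 + a) ^+ i.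
  apply: le_trans (h k (leqnn k)) _.
  rewrite ler_wpM2l ?mulr_ge0// expRM_natl.
  by rewrite lerXn2r ?nnegrE ?expR_ge0 ?expR_ge1Dx ?addr_ge0.
elim: i => [_|i IH ik]; first by rewrite u0 !mul0r.
apply: le_trans (ih _ ik) _.
have a1 : 0 <= 1 + a by rewrite addr_ge0.
apply: (@le_trans _ _ ((1 + a) * (i%:R * b * (1 + a) ^+ i) + b)).
  by rewrite lerD2r ler_wpM2l// IH// ltnW.
have : b <= b * (1 + a) ^+ i.+1.
  by rewrite ler_peMr// exprn_ege1// lerDl.
by rewrite exprS -natr1; lra.
Qed.

End gronwall.

(** * The inequality on the sign cube *)

Section cube_Xp.
Context {R : realType}.
Implicit Types (p c : R).

(** The first summand comes from [k] Gronwall steps of rate [2 two_point_const p / k], the second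
    from the range [n < 2 k], where no induction is made. *)
Definition cube_const p : R :=
  2 * two_point_const p * expR (2 * two_point_const p) + 2 `^ p.

Lemma cube_const_gt0 p : 2 <= p -> 0 < cube_const p.
Proof.
move=> p2; have K0 := two_point_const_gt0 p2.
by rewrite addr_gt0 ?powR_gt0// !mulr_gt0 ?expR_gt0.
Qed.

Lemma cube_Xp_centered p n k (h : cube n -> R) :
  2 <= p -> (1 <= k <= n)%N -> avg h = 0 ->
  level_avg (fun S => avg (fun e => `|cond S h e| `^ p)) k <=
  cube_const p * (k%:R / n%:R *
    (\sum_j avg (fun e => `|(h e - h (flip j e)) / 2| `^ p))
   + (k%:R / n%:R) `^ (p / 2) * avg (fun e => `|h e| `^ p)).
Proof.
move=> p2 /andP[k0 kn] h0.
set D := \sum_j _; set H := avg _; set K := two_point_const p.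
have K0 : 0 < K := two_point_const_gt0 p2.
have n0 : (0 < n)%N := leq_trans k0 kn.
have nR : (0 : R) < n%:R by rewrite ltr0n.
have kR : (0 : R) < k%:R by rewrite ltr0n.
have D0 : 0 <= D.
  by apply: sumr_ge0 => j _; apply: avg_ge0 => e; exact: powR_ge0.
have H0 : 0 <= H by apply: avg_ge0 => e; exact: powR_ge0.
set q : R := k%:R / n%:R; have q0 : 0 < q by rewrite divr_gt0.
have qD0 : 0 <= q * D := mulr_ge0 (ltW q0) D0.
have qH0 : 0 <= q `^ (p / 2) * H := mulr_ge0 (powR_ge0 _ _) H0.
have KE0 : 0 <= 2 * K * expR (2 * K).
  exact: mulr_ge0 (mulr_ge0 (ler0n _ 2) (ltW K0)) (expR_ge0 _).
(* If [k > n / 2], then [4 k / n >= 1], and contractivity of [cond] gives the bound with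
   [2^p = 4^(p / 2)] and the last term alone. *)
have [nk|kn2] := ltnP n (2 * k).
  have : level_avg (fun S => avg (fun e => `|cond S h e| `^ p)) k <= H.
    rewrite -[leRHS](@level_avg_cst _ n _ k kn); apply: level_avg_le => S.
    by apply: avg_powR_cond; lra.
  move=> /le_trans; apply.
  rewrite /cube_const -/K mulrDl -[leLHS]add0r lerD//.
    exact: mulr_ge0 KE0 (addr_ge0 qD0 qH0).
  rewrite mulrDr -[leLHS]add0r lerD//; first exact: mulr_ge0 (powR_ge0 _ _) qD0.
  rewrite mulrA -[2 `^ p](@sqr_powR _ 2 p)// -powRM ?sqr_ge0 ?(ltW q0)//.
  apply: ler_peMl => //; apply: (@le_trans _ _ (1 `^ (p / 2))).
    by rewrite powR1.
  have q1 : 1 <= 2 ^+ 2 * q.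
    rewrite /q mulrA ler_pdivlMr// mul1r -natrX -natrM ler_nat.
    by rewrite (leq_trans (ltnW nk))// leq_mul2r orbT.
  by apply: ge0_ler_powR; rewrite ?nnegrE//; lra.
(* This Young parameter makes the growth per level [K tau / (n - i)], at most [2 K / k], so that [k]
   levels multiply by at most [expR (2 K)]; it also turns [tau^(1 - p / 2) / n] into
   [q^(p / 2) / k]. *)
pose tau := q^-1; have tau0 : 0 < tau by rewrite invr_gt0.
pose a (S : {set 'I_n}) := avg (fun e => `|cond S h e| `^ p).
pose d j := K * avg (fun e => `|(h e - h (flip j e)) / 2| `^ p).
have step (S : {set 'I_n}) : \sum_(j | j \notin S) a (j |: S) <=
    ((n - #|S|)%:R + K * tau) * a S + K * (tau `^ (1 - p / 2) * H)
    + \sum_(j | j \notin S) d j.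
  pose w e := `|cond S h e| `^ (p - 2).
  apply: (@le_trans _ _ (\sum_(j | j \notin S)
      (a S + (K * avg (fun e => w e * incr S j h e ^+ 2) + d j)))).
    apply: ler_sum => j jS; rewrite -mulrDr; exact: avg_powR_cond_setU1.
  have h1 : \sum_(j | j \notin S) a S = (n - #|S|)%:R * a S.
    have <- : #|~: S| = (n - #|S|)%N by rewrite cardsCs finset.setCK card_ord.
    rewrite sumr_const mulr_natl.
    by congr (_ *+ _); apply: eq_card => j; rewrite !inE.
  have h2 : \sum_(j | j \notin S) avg (fun e => w e * incr S j h e ^+ 2) <=
      tau * a S + tau `^ (1 - p / 2) * H.
    apply: le_trans (bessel_incr _ _ _) _.
    - by move=> e f; rewrite /w cond_depends.
    - by move=> e; exact: powR_ge0.
    - rewrite /a /H -!avgZ -avgD; apply: le_avg => e.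
      rewrite -[h e ^+ 2]real_normK ?num_real//; exact: powR_young.
  have := ler_wpM2l (ltW K0) h2.
  rewrite !big_split h1 -(mulr_sumr _ _ (fun j => avg (fun e => w e * incr S j h e ^+ 2))) /=.
  set s1 := \sum_(j | _) avg _; set s2 := \sum_(j | _) d j.
  by move: (a S) s1 s2 => u1 s1 s2; lra.
have up i : (i < k)%N -> level_avg a i.+1 <= (1 + 2 * K / k%:R) * level_avg a i +
    (2 * K / k%:R * q `^ (p / 2) * H + K * D / n%:R).
  move=> ik; have ltin := leq_trans ik kn.
  have N0 : (0 : R) < (n - i)%:R by rewrite ltr0n subn_gt0.
  apply: le_trans (level_avg_up ltin _) _.
    by move=> S <-; exact: step.
  (* Since [i < k] and [2 k <= n], at least half of the coordinates are still outside the set. *)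
  have inv : (n - i)%:R^-1 <= 2 / n%:R :> R.
    rewrite -[leRHS]invf_div lef_pV2 ?posrE ?divr_gt0//.
    have nNi : (n <= (n - i) * 2)%N by clear -ik kn2; lia.
    by rewrite ler_pdivrMr// -natrM ler_nat.
  have tq : tau `^ (1 - p / 2) / n%:R = q `^ (p / 2) / k%:R.
    rewrite /tau -(powR_inv1 (ltW q0)) -powRrM.
    rewrite (_ : -1 * _ = p / 2 - 1); last by lra.
    rewrite powRB; last by rewrite (gt_eqF q0) implybT.
    rewrite powRr1 ?(ltW q0)// /q.
    by field; rewrite !gt_eqF.
  rewrite -addrA lerD//.
    rewrite ler_wpM2r ?level_avg_ge0//.
      by move=> S; apply: avg_ge0 => e; exact: powR_ge0.
    rewrite lerD2l; apply: le_trans (ler_wpM2l _ inv) _.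
      by rewrite mulr_ge0 ?ltW.
    by rewrite /tau /q le_eqVlt; apply/orP; left; apply/eqP; field; rewrite !gt_eqF.
  rewrite lerD//; last by rewrite -mulr_sumr.
  apply: le_trans (ler_wpM2l _ inv) _.
    exact: mulr_ge0 (ltW K0) (mulr_ge0 (powR_ge0 _ _) H0).
  rewrite le_eqVlt; apply/orP; left; apply/eqP.
  transitivity (2 * K * H * (tau `^ (1 - p / 2) / n%:R)); first by ring.
  by rewrite tq; ring.
have a0 : level_avg a 0 = 0.
  rewrite /level_avg big1 ?mulr0// => S; rewrite cards_eq0 => /eqP ->.
  rewrite /a (eq_avg (G := fun=> 0)) ?avg_cst ?card_cube_gt0// => e.
  by rewrite cond0 h0 normr0 powR0// gt_eqF//; lra.
have A0 : 0 <= 2 * K / k%:R.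
  exact: divr_ge0 (mulr_ge0 (ler0n _ 2) (ltW K0)) (ltW kR).
have B0 : 0 <= 2 * K / k%:R * q `^ (p / 2) * H + K * D / n%:R.
  apply: addr_ge0; last exact: divr_ge0 (mulr_ge0 (ltW K0) D0) (ltW nR).
  by rewrite -mulrA; exact: mulr_ge0 A0 qH0.
apply: le_trans (discrete_gronwall A0 B0 a0 up) _.
have -> : k%:R * (2 * K / k%:R) = 2 * K :> R by rewrite mulrC divfK ?gt_eqF.
have -> : k%:R * (2 * K / k%:R * q `^ (p / 2) * H + K * D / n%:R) =
   2 * K * (q `^ (p / 2) * H) + K * (q * D).
  by rewrite /q; field; rewrite !gt_eqF.
rewrite /cube_const -/K.
have : 0 <= 2 * K * expR (2 * K) * (q * D) := mulr_ge0 KE0 qD0.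
have : 0 <= 2 `^ p * (q * D) := mulr_ge0 (powR_ge0 _ _) qD0.
have : 0 <= 2 `^ p * (q `^ (p / 2) * H) := mulr_ge0 (powR_ge0 _ _) qH0.
lra.
Qed.

(** Centring [h] at its mean instead of [c] costs at most [2^p], because the mean is itself within
    the [p]-average distance of [c]. On the torus [c] is the value of [f] at the undisplaced point,
    which turns the last average into increments of [f]. *)
Lemma cube_Xp p n k (h : cube n -> R) c :
  2 <= p -> (1 <= k <= n)%N ->
  level_avg (fun S => avg (fun e => `|cond S h e - avg h| `^ p)) k <=
  cube_const p * 2 `^ p * (k%:R / n%:R *
    (\sum_j avg (fun e => `|(h e - h (flip j e)) / 2| `^ p))
   + (k%:R / n%:R) `^ (p / 2) * avg (fun e => `|h e - c| `^ p)).
Proof.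
move=> p2 hk; have p1 : 1 <= p by lra.
have n0 := @card_cube_gt0 n.
pose h' e := h e - avg h.
have h'0 : avg h' = 0 by rewrite avgB avg_cst// subrr.
have := cube_Xp_centered p2 hk h'0.
have -> : (fun S => avg (fun e => `|cond S h' e| `^ p)) =
    (fun S => avg (fun e => `|cond S h e - avg h| `^ p)).
  apply/funext => S; apply: eq_avg => e.
  by rewrite /h' /cond avgB avg_cst.
move=> /le_trans; apply; rewrite -[leRHS]mulrA; apply: ler_wpM2l.
  exact/ltW/cube_const_gt0.
rewrite mulrDr; apply: lerD.
  have -> : \sum_j avg (fun e => `|(h' e - h' (flip j e)) / 2| `^ p) =
      \sum_j avg (fun e => `|(h e - h (flip j e)) / 2| `^ p).
    apply: eq_bigr => j _; apply: eq_avg => e.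
    by congr (`|_ / 2| `^ p); rewrite /h'; ring.
  apply: ler_peMl.
    rewrite mulr_ge0 ?divr_ge0// sumr_ge0// => j _.
    by apply: avg_ge0 => e; exact: powR_ge0.
  by rewrite -[leLHS](powRr0 2); apply: ler_powR; lra.
rewrite [leRHS]mulrCA; apply: ler_wpM2l; first exact: powR_ge0.
apply: (@le_trans _ _ (avg (fun e => 2 `^ (p - 1) *
    (`|h e - c| `^ p + `|avg (fun e => c - h e)| `^ p)))).
  apply: le_avg => e; apply: le_trans (powR_add_le _ _ p1).
  by rewrite avgB avg_cst// addrA subrK.
set u := `|avg _| `^ p.
have -> : avg (fun e => 2 `^ (p - 1) * (`|h e - c| `^ p + u)) =
    2 `^ (p - 1) * (avg (fun e => `|h e - c| `^ p) + u).
  rewrite avgZ; congr (_ * _).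
  by rewrite (avgD (fun e => `|h e - c| `^ p)) avg_cst.
have uH : u <= avg (fun e => `|h e - c| `^ p).
  apply: le_trans (avg_powR _ p1) _; apply: le_avg => e.
  by rewrite distrC.
apply: le_trans (ler_wpM2l (powR_ge0 _ _) (lerD (lexx _) uH)) _.
by rewrite -(@mulr_powRB1 _ 2 p)//; lra.
Qed.

End cube_Xp.

Local Open Scope classical_set_scope.
Local Open Scope ring_scope.
Local Notation wrap := Defs.wrap.

(** * Invariance of the integral over the torus *)

Section box_integral.
Context d (T : measurableType d) (R : realType).
Variable mu : {sigma_finite_measure set T -> \bar R}.
Variables (D : set T) (mD : measurable D).
Local Notation P := (power_measure mu).
Local Open Scope ereal_scope.

Definition box n : set (n.-tuple T) := [set x | forall i, D (tnth x i)].
Arguments box n _ : clear implicits.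

Lemma measurable_box n : measurable (box n).
Proof.
rewrite (_ : box n = \bigcap_(i : 'I_n) ((@tnth n T ^~ i) @^-1` D)).
  apply: fin_bigcap_measurable; first exact: finite_finset.
  by move=> i _; rewrite -[X in measurable X]setTI; exact: measurable_tnth.
by apply/seteqP; split => [x h i _|x h i]; exact: h.
Qed.

Lemma box_cons n t (x : n.-tuple T) :
  box n.+1 (tuple_cons (t, x)) <-> D t /\ box n x.
Proof.
split=> [h|[Dt Dx] i].
  split; first by have := h ord0; rewrite tnth0.
  by move=> i; have := h (lift ord0 i); rewrite tnthS.
by case: (unliftP ord0 i) => [j|] ->; rewrite ?tnthS ?tnth0.
Qed.

Lemma integral_power_cons n (F : n.+1.-tuple T -> \bar R) :
  measurable_fun [set: _] F -> (forall x, 0 <= F x) ->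
  \int[P n.+1]_x F x = \int[mu]_t \int[P n]_x F (tuple_cons (t, x)).
Proof.
move=> mF F0.
have -> : \int[P n.+1]_x F x = \int[mu \x P n]_z (F \o (@tuple_cons _ T n)) z.
  rewrite [LHS](_ : _ = \int[pushforward (mu \x P n) (@tuple_cons _ T n)]_x F x)//.
  by rewrite ge0_integral_pushforward//; exact: measurable_tuple_cons.
apply: (fubini_tonelli1 (F \o @tuple_cons _ T n)); last by move=> x; exact: F0.
by apply: measurableT_comp => //; exact: measurable_tuple_cons.
Qed.

Lemma measurable_pair_tuple_cons n (F : n.+1.-tuple T -> \bar R) :
  measurable_fun setT F -> measurable_fun setT (fun z => F (@tuple_cons _ T n z)).
Proof. by move=> mF; apply: measurableT_comp => //; exact: measurable_tuple_cons. Qed.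

Lemma integral_box_cons n (F : n.+1.-tuple T -> \bar R) :
  measurable_fun [set: _] F -> (forall x, 0 <= F x) ->
  \int[P n.+1]_(x in box n.+1) F x =
  \int[mu]_(t in D) \int[P n]_(x in box n) F (tuple_cons (t, x)).
Proof.
move=> mF F0; rewrite integral_mkcond integral_power_cons; last 2 first.
- exact: (measurable_restrictT F (@measurable_box n.+1)).1 (measurable_funTS mF).
- by move=> x; exact: erestrict_ge0.
rewrite [RHS]integral_mkcond; apply: eq_integral => t _; rewrite patchE.
case: ifPn => [/set_mem Dt|/negP Dt].
  rewrite [RHS]integral_mkcond; apply: eq_integral => x _; rewrite !patchE.
  have [bx|bx] := pselect (box n x).
    by rewrite !mem_set//; apply/box_cons.
  by rewrite !memNset// => /box_cons[].
rewrite integral0_eq// => x _; rewrite patchE memNset// => /box_cons[Dt' _].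
by apply: Dt; exact: mem_set.
Qed.

Lemma measurable_integral_box n d' (U : measurableType d') (F : U * n.-tuple T -> \bar R) :
  measurable_fun [set: _] F -> (forall x, 0 <= F x) ->
  measurable_fun setT (fun t => \int[P n]_(x in box n) F (t, x)).
Proof.
move=> mF F0; under eq_fun do rewrite integral_mkcond.
pose G z := (F \_ (setT `*` box n)) z.
have mG : measurable_fun setT G.
  apply: (measurable_restrictT F _).1 (measurable_funTS mF).
  by apply: measurableX => //; exact: measurable_box.
have := measurable_fun_fubini_tonelli_F (m2 := P n) G mG.
rewrite (_ : fubini_F _ _ = fun t => \int[P n]_x ((fun x => F (t, x)) \_ (box n)) x).
  by apply => z; exact: erestrict_ge0.
apply/funext => t; apply: eq_integral => x _; rewrite /G !patchE.
have [bx|bx] := pselect (box n x); first by rewrite !mem_set.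
by rewrite !memNset// => -[].
Qed.

(** Invariance passes from one coordinate to the product by peeling off coordinates with Tonelli.
    Translations modulo 1 and sign changes, with a different map in each coordinate, are the two
    instances. *)
Lemma integral_box_map n (phi : 'I_n -> T -> T) (F : n.-tuple T -> \bar R) :
  (forall i, measurable_fun setT (phi i)) ->
  (forall i (g : T -> \bar R), measurable_fun setT g -> (forall t, 0 <= g t) ->
     \int[mu]_(t in D) g (phi i t) = \int[mu]_(t in D) g t) ->
  measurable_fun [set: _] F -> (forall x, 0 <= F x) ->
  \int[P n]_(x in box n) F [tuple phi i (tnth x i) | i < n] =
  \int[P n]_(x in box n) F x.
Proof.
elim: n phi F => [|n IH] phi F mphi iphi mF F0.
  by apply: eq_integral => x _; congr F; apply: eq_from_tnth => -[].
have mmap m (psi : 'I_m -> T -> T) : (forall i, measurable_fun setT (psi i)) ->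
    measurable_fun setT (fun x : m.-tuple T => [tuple psi i (tnth x i) | i < m]).
  move=> mpsi; apply/measurable_fun_tnthP => i.
  rewrite (_ : _ \o _ = psi i \o (@tnth m T)^~ i).
    by apply: measurableT_comp => //; exact: measurable_tnth.
  by apply/funext => x /=; rewrite tnth_mktuple.
rewrite integral_box_cons//; last by apply: measurableT_comp => //; exact: mmap.
rewrite [RHS](integral_box_cons mF F0).
pose G t := \int[P n]_(x in box n) F (tuple_cons (t, x)).
have mFc t : measurable_fun setT (fun x => F (tuple_cons (t, x))).
  apply: (measurableT_comp (measurable_pair_tuple_cons mF)).
  exact: pair1_measurable.
rewrite -[RHS](iphi ord0 G); last 2 first.
- exact: measurable_integral_box (measurable_pair_tuple_cons mF) _.
- by move=> t; exact: integral_ge0.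
apply: eq_integral => t _.
rewrite /G -(IH (fun i => phi (lift ord0 i)) _ (fun i => mphi _) (fun i => iphi _)
  (mFc _) (fun=> F0 _)).
apply: eq_integral => x _; congr F; apply: eq_from_tnth => i.
rewrite tnth_mktuple; case: (unliftP ord0 i) => [j|] ->.
  by rewrite !tnthS tnth_mktuple.
by rewrite !tnth0.
Qed.

End box_integral.
Arguments box {d T} D n _.

Section wrap.
Context {R : realType}.
Implicit Types (s t c : R).

Lemma wrap_itv t : wrap t \in `[- 2^-1, 2^-1[.
Proof.
have := floor_itv (t + 2^-1); rewrite /wrap in_itv/= intrD => /andP[h1 h2].
by apply/andP; split; lra.
Qed.

Lemma wrap_id t : t \in `[- 2^-1, 2^-1[ -> wrap t = t.
Proof.
rewrite in_itv/= => /andP[h1 h2]; rewrite /wrap (@Num.Theory.floor_def _ _ 0) ?subr0//.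
by rewrite add0r; apply/andP; split; lra.
Qed.

Lemma wrapDz t (z : int) : wrap (t + z%:~R) = wrap t.
Proof.
have floorDz : Num.floor (t + z%:~R + 2^-1) = Num.floor (t + 2^-1) + z.
  by rewrite addrAC floorDrz ?intr_int// intrKfloor.
rewrite /wrap floorDz.
by rewrite intrD; ring.
Qed.

Lemma wrap_wrapD s t : wrap (wrap s + t) = wrap (s + t).
Proof.
rewrite -[RHS](wrapDz _ (- Num.floor (s + 2^-1))) {2}/wrap mulrNz.
by congr wrap; ring.
Qed.

Lemma measurable_wrap : measurable_fun setT (@wrap R).
Proof.
apply: measurable_funB => //; apply: nondecreasing_measurable => // s t st.
by rewrite ler_int le_floor// lerD2r.
Qed.

End wrap.

Section unit_interval_integral.
Context {R : realType}.
Local Notation mu := (@lebesgue_measure R).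
Local Notation I := `[- (2^-1 : R), 2^-1[%classic.
Local Open Scope ereal_scope.
Implicit Types (g : R -> \bar R) (c : R).

Lemma lebesgue_measure_shift c (A : set R) : measurable A ->
  pushforward mu (fun t : measurableTypeR R => t + c : measurableTypeR R)%R A = mu A.
Proof.
move=> mA.
have mc : measurable_fun setT (fun t : measurableTypeR R => t + c : measurableTypeR R)%R.
  exact: measurable_funD.
pose phi : {mfun measurableTypeR R >-> measurableTypeR R} :=
  HB.pack (fun t : measurableTypeR R => t + c : measurableTypeR R)%R
    (isMeasurableFun.Build _ _ _ _ _ mc).
apply/esym; apply: (@lebesgue_measure_unique R (pushforward mu phi)) => //.
move=> _ [[a b]] _ <-.
transitivity (mu `](a - c)%R, (b - c)%R]%classic); last first.
  congr (mu _); apply/seteqP; split => x /=;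
    by rewrite !in_itv/= ltrBlDr lerBrDr.
rewrite !lebesgue_measure_itv/= !lte_fin ltrD2r.
by case: ifPn => // _; rewrite -!EFinB opprB addrA subrK.
Qed.

Lemma ge0_integral_shift c (D : set R) g : measurable D ->
  measurable_fun setT g -> (forall t, 0 <= g t) ->
  \int[mu]_(t in (fun t => t + c)%R @^-1` D) g (t + c)%R = \int[mu]_(t in D) g t.
Proof.
move=> mD mg g0.
have mc : measurable_fun setT (fun t : measurableTypeR R => t + c : measurableTypeR R)%R.
  exact: measurable_funD.
rewrite -(ge0_integral_pushforward mc)//; last exact: measurable_funTS.
by apply: eq_measure_integral => //= A mA AS; exact: lebesgue_measure_shift.
Qed.

Lemma ge0_integral_opp (D : set R) g : measurable D ->
  measurable_fun setT g -> (forall t, 0 <= g t) ->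
  \int[mu]_(t in -%R @^-1` D) g (- t)%R = \int[mu]_(t in D) g t.
Proof.
move=> mD mg g0.
have mgD : measurable_fun D g by exact: measurable_funTS.
rewrite [LHS](_ : _ = \int[mu]_(t in (-%R : _ -> measurableTypeR R) @^-1` D) g (- t)%R)//.
rewrite -ge0_integral_pushforward//=.
by apply: eq_measure_integral => //= A mA AS; exact: lebesgue_measureN.
Qed.

(** The half-open interval is not symmetric; removing its endpoint, a null set, makes it so. *)
Lemma ge0_integral_unit_opp g : measurable_fun setT g -> (forall t, 0 <= g t) ->
  \int[mu]_(t in I) g (- t)%R = \int[mu]_(t in I) g t.
Proof.
move=> mg g0; rewrite [RHS]integral_itv_bndoo; last exact: measurable_funTS.
rewrite integral_itv_bndoo; last first.
  by apply: measurable_funTS; apply: measurableT_comp => //; exact: oppr_measurable.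
rewrite -[RHS]ge0_integral_opp//.
by rewrite opp_preimage_itvbndbnd/= opprK.
Qed.

(** By periodicity [c] may be taken in [[0, 1)]. The shifted interval is then cut at [1/2], and the
    part that sticks out is moved back by 1 to fill the gap on the left. *)
Lemma ge0_integral_unit_wrap c g : measurable_fun setT g -> (forall t, 0 <= g t) ->
  \int[mu]_(t in I) g (wrap (t + c)) = \int[mu]_(t in I) g t.
Proof.
move=> mg g0.
wlog /andP[c0 c1] : c / (0 <= c < 1)%R.
  move=> h; rewrite -(h (c - (Num.floor c)%:~R)%R).
    by apply: eq_integral => t _; rewrite addrA -mulrNz wrapDz.
  have := floor_itv c; rewrite intrD => /andP[h1 h2].
  by apply/andP; split; lra.
pose G t := g (wrap t).
have mG : measurable_fun setT G by apply: measurableT_comp => //; exact: measurable_wrap.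
have G0 t : 0 <= G t by exact: g0.
have shift a b e : (fun t : R => t + e)%R @^-1` `[a, b[%classic
    = `[(a - e)%R, (b - e)%R[%classic.
  by apply/seteqP; split => x /=; rewrite !in_itv/= lerBlDr ltrBrDr.
have split a b e : (a <= b <= e)%R -> \int[mu]_(t in `[a, e[) G t =
    \int[mu]_(t in `[a, b[) G t + \int[mu]_(t in `[b, e[) G t.
  move=> /andP[ab be]; rewrite -ge0_integral_setU//.
  - congr (integral _ _ _); apply/seteqP; split => x /=; rewrite !in_itv/=.
      move=> /andP[ax xe]; case: (ltP x b) => xb; [left|right] => //.
      by rewrite ax.
    by move=> [] /andP[? ?]; apply/andP; split; lra.
  - exact: measurable_funTS.
  - rewrite disj_set2E; apply/eqP/seteqP; split => x //=; rewrite !in_itv/=.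
    by move=> [/andP[_ h1] /andP[h2 _]]; lra.
transitivity (\int[mu]_(t in `[(- 2^-1 + c)%R, (2^-1 + c)%R[) G t).
  by rewrite -[RHS](ge0_integral_shift c)// shift !addrK.
rewrite (split _ 2^-1%R); last by apply/andP; split; lra.
rewrite -(ge0_integral_shift 1 (D := `[2^-1%R, (2^-1 + c)%R[%classic))// shift.
rewrite (_ : 2^-1 - 1 = - 2^-1 :> R)%R; last by lra.
rewrite (_ : 2^-1 + c - 1 = - 2^-1 + c :> R)%R; last by lra.
rewrite addeC; transitivity (\int[mu]_(t in I) G t).
  rewrite (split (- 2^-1)%R (- 2^-1 + c)%R 2^-1%R); last first.
    by apply/andP; split; lra.
  congr (_ + _); apply: eq_integral => t _.
  by rewrite /G -[1%R]/(1%:~R)%R wrapDz.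
by apply: eq_integral => t /set_mem tI; rewrite /G wrap_id.
Qed.

End unit_interval_integral.

Section torus_integral.
Context {R : realType} {n : nat}.
Local Notation L := (measurableTypeR R).
Local Notation X := (n.-tuple L).
Local Notation m := (power_measure (@lebesgue_measure R) n).
Local Notation I := (`[- (2^-1 : R), 2^-1[%classic : set L).
Implicit Types (G H : X * X -> R) (c : R).

Lemma torusE : torus n = box I n.
Proof. by apply/seteqP; split => x h i; have := h i; rewrite /= in_itv. Qed.

Lemma measurable_torus : measurable (torus n : set X).
Proof. by rewrite torusE; apply: measurable_box. Qed.

(** Integrals may be infinite, so the calculus of [torus_int] is kept to nonnegative Borel
    integrands, for which Tonelli and additivity hold in the extended reals. *)
Definition nnmeasurable G := measurable_fun setT G /\ forall z, 0 <= G z.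

Definition torus_int G : \bar R :=
  (\int[m]_(x in torus n) \int[m]_(y in torus n) (G (x, y))%:E)%E.

Local Open Scope ereal_scope.

Let mpair G : nnmeasurable G ->
  measurable_fun setT (fun z : X * X => (G z)%:E) /\ forall z, 0 <= (G z)%:E.
Proof. by move=> [mG G0]; split; [exact/measurable_EFinP|]. Qed.

Lemma measurable_section G x : nnmeasurable G ->
  measurable_fun (torus n : set X) (fun y => (G (x, y))%:E).
Proof.
move=> /mpair[mG _]; apply: measurable_funTS.
by apply: (measurableT_comp mG); exact: pair1_measurable.
Qed.

Lemma measurable_marginal G : nnmeasurable G ->
  measurable_fun (torus n : set X) (fun x => \int[m]_(y in torus n) (G (x, y))%:E).
Proof.
move=> /mpair[mG G0]; apply: measurable_funTS; rewrite torusE.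
exact: (measurable_integral_box _ _ mG G0).
Qed.

Lemma torus_int_ge0 G : nnmeasurable G -> 0 <= torus_int G.
Proof.
by case=> _ G0; apply: integral_ge0 => x _; apply: integral_ge0 => y _; rewrite lee_fin.
Qed.

Lemma torus_int_le G H : nnmeasurable G -> nnmeasurable H ->
  (forall z, (G z <= H z)%R) -> torus_int G <= torus_int H.
Proof.
move=> hG hH GH; have [[_ G0] [_ H0]] := (hG, hH).
apply: ge0_le_integral => //.
- exact: measurable_torus.
- by move=> x _; apply: integral_ge0 => y _; rewrite lee_fin.
- exact: measurable_marginal.
- exact: measurable_marginal.
move=> x _; apply: ge0_le_integral => //.
- exact: measurable_torus.
- by move=> y _; rewrite lee_fin.
- exact: measurable_section.
- exact: measurable_section.
- by move=> y _; rewrite lee_fin.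
Qed.

Lemma torus_intD G H : nnmeasurable G -> nnmeasurable H ->
  torus_int (fun z => G z + H z)%R = torus_int G + torus_int H.
Proof.
move=> hG hH; have [[_ G0] [_ H0]] := (hG, hH).
rewrite /torus_int -ge0_integralD//.
- apply: eq_integral => x _; rewrite -ge0_integralD//.
  + exact: measurable_torus.
  + by move=> y _; rewrite lee_fin.
  + exact: measurable_section.
  + by move=> y _; rewrite lee_fin.
  + exact: measurable_section.
- exact: measurable_torus.
- by move=> x _; apply: integral_ge0 => y _; rewrite lee_fin.
- exact: measurable_marginal.
- by move=> x _; apply: integral_ge0 => y _; rewrite lee_fin.
- exact: measurable_marginal.
Qed.

Lemma torus_intZ c G : (0 <= c)%R -> nnmeasurable G ->
  torus_int (fun z => c * G z)%R = c%:E * torus_int G.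
Proof.
move=> c0 hG; have [_ G0] := hG.
rewrite /torus_int -ge0_integralZl_EFin//.
- apply: eq_integral => x _; rewrite -ge0_integralZl_EFin//.
  + exact: measurable_torus.
  + by move=> y _; rewrite lee_fin.
  + exact: measurable_section.
- exact: measurable_torus.
- by move=> x _; apply: integral_ge0 => y _; rewrite lee_fin.
- exact: measurable_marginal.
Qed.

Lemma nnmeasurableD G H : nnmeasurable G -> nnmeasurable H ->
  nnmeasurable (fun z => G z + H z)%R.
Proof.
by move=> [mG G0] [mH H0]; split; [exact: measurable_funD|move=> z; exact: addr_ge0].
Qed.

Lemma nnmeasurableZ c G : (0 <= c)%R -> nnmeasurable G -> nnmeasurable (fun z => c * G z)%R.
Proof.
by move=> c0 [mG G0]; split; [exact: measurable_funM|move=> z; exact: mulr_ge0].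
Qed.

Lemma nnmeasurable_sum (J : Type) (r : seq J) (P : pred J) (G : J -> X * X -> R) :
  (forall j, nnmeasurable (G j)) ->
  nnmeasurable (fun z => \sum_(j <- r | P j) G j z)%R.
Proof.
move=> hG; split; last by move=> z; apply: sumr_ge0 => j _; case: (hG j).
rewrite (_ : (fun _ => _) = (fun z => \sum_(j <- r) (if P j then G j z else 0)))%R.
  apply: measurable_sum => j; case: (P j); last exact: measurable_cst.
  by case: (hG j).
by apply/funext => z; rewrite big_mkcond.
Qed.

Lemma torus_int0 : torus_int (fun=> 0%R) = 0.
Proof. by apply: integral0_eq => x _; apply: integral0_eq. Qed.

Lemma torus_int_sum (J : Type) (r : seq J) (P : pred J) (G : J -> X * X -> R) :
  (forall j, nnmeasurable (G j)) ->
  torus_int (fun z => \sum_(j <- r | P j) G j z)%R =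
  \sum_(j <- r | P j) torus_int (G j).
Proof.
move=> hG; elim: r => [|j r IH].
  rewrite big_nil -torus_int0; congr torus_int.
  by apply/funext => z; rewrite big_nil.
rewrite big_cons -IH; case: ifPn => Pj; last first.
  by congr torus_int; apply/funext => z; rewrite big_cons (negbTE Pj).
rewrite -(torus_intD (hG j) (nnmeasurable_sum r P hG)).
by congr torus_int; apply/funext => z; rewrite big_cons Pj.
Qed.

Lemma torus_int_swap G : nnmeasurable G ->
  torus_int G = \int[m]_(y in torus n) \int[m]_(x in torus n) (G (x, y))%:E.
Proof.
move=> hG; have [mG G0] := mpair hG.
pose F (z : X * X) := if (z.1 \in torus n) && (z.2 \in torus n) then (G z)%:E else 0.
have mF : measurable_fun setT F.
  rewrite (_ : F = (fun z => (G z)%:E) \_ (torus n `*` torus n)).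
    apply: (measurable_restrictT _ _).1 (measurable_funTS mG).
    by apply: measurableX; exact: measurable_torus.
  apply/funext => z; rewrite /F patchE; congr (if _ then _ else _).
  by apply/andP/idP => [[/set_mem ? /set_mem ?]|/set_mem[? ?]];
    [exact: mem_set|split; exact: mem_set].
have F0 z : 0 <= F z by rewrite /F; case: ifP.
have := @fubini_tonelli _ _ _ _ _ m m F mF F0.
congr (_ = _); rewrite [RHS]integral_mkcond; apply: eq_integral => x _;
  rewrite patchE; case: ifPn => hx.
- by rewrite [RHS]integral_mkcond; apply: eq_integral => y _; rewrite patchE /F/= hx.
- by rewrite integral0_eq// => y _; rewrite /F/= (negbTE hx).
- rewrite [RHS]integral_mkcond; apply: eq_integral => y _.
  by rewrite patchE /F/= hx andbT.
- by rewrite integral0_eq// => y _; rewrite /F/= (negbTE hx) andbF.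
Qed.

(** The translation depends on [y], so the order of integration is exchanged first: for fixed [y] it
    is an ordinary translation in [x]. *)
Lemma torus_int_shift (w : X -> X) G : nnmeasurable G ->
  nnmeasurable (fun z => G (torus_add z.1 (w z.2), z.2)) ->
  torus_int (fun z => G (torus_add z.1 (w z.2), z.2)) = torus_int G.
Proof.
move=> hG hG'; rewrite torus_int_swap// [RHS]torus_int_swap//=.
apply: eq_integral => y _; rewrite torusE.
apply: (@integral_box_map _ L R (@lebesgue_measure R) I (measurable_itv _) n
  (fun i (t : R) => wrap (t + tnth (w y) i))
  (fun x => (G (x, y))%:E)).
- by move=> i; apply: measurableT_comp; [exact: measurable_wrap|exact: measurable_funD].
- by move=> i g mg g0; exact: ge0_integral_unit_wrap.
- have [mG _] := mpair hG.
  by apply: (measurableT_comp mG); exact: pair2_measurable.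
- by move=> x; rewrite lee_fin; case: hG.
Qed.

Definition reflect_coords (e : 'I_n -> bool) (y : X) : X :=
  [tuple (if e i then - tnth y i else tnth y i)%R | i < n].

Lemma torus_int_reflect (e : 'I_n -> bool) G : nnmeasurable G ->
  torus_int (fun z => G (z.1, reflect_coords e z.2)) = torus_int G.
Proof.
move=> hG; apply: eq_integral => x _; rewrite torusE.
apply: (@integral_box_map _ L R (@lebesgue_measure R) I (measurable_itv _) n
  (fun i (t : R) => if e i then - t else t)%R
  (fun y => (G (x, y))%:E)).
- by move=> i; case: (e i) => //; exact: oppr_measurable.
- by move=> i g mg g0; case: (e i) => //; exact: ge0_integral_unit_opp.
- have [mG _] := mpair hG.
  by apply: (measurableT_comp mG); exact: pair1_measurable.
- by move=> y; rewrite lee_fin; case: hG.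
Qed.

End torus_integral.

(** * Increments along displacements *)

Lemma sume_cst {R : realType} (T : finType) (P : pred T) (Q : \bar R) :
  (\sum_(t | P t) Q = (#|P|%:R)%:E * Q)%E.
Proof.
rewrite big_const; elim: #|P| => [|r IH]; first by rewrite mul0e.
by rewrite iterS IH -nat1r EFinD ge0_muleDl ?lee_fin// mul1e.
Qed.

Section displacement.
Context {R : realType} {n : nat}.
Local Notation L := (measurableTypeR R).
Local Notation X := (n.-tuple L).
Implicit Types (v w : 'I_n -> R) (e : cube n) (S : {set 'I_n}) (z : X * X).

(** One coefficient vector [v] encodes all displacements in play: an indicator gives [y_S], a
    multiple of a basis vector gives [y_j e_j / (4 m)], a constant gives [y / (4 m)]. Translations
    of [x] along [y] add to [v], and reflections of [y] change its signs. *)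
Definition displaced v z : X :=
  [tuple wrap ((tnth z.1 i : R) + v i * tnth z.2 i) | i < n].

Lemma displaced_torus v z : torus n (displaced v z).
Proof.
move=> i; rewrite tnth_mktuple.
by have := wrap_itv ((tnth z.1 i : R) + v i * tnth z.2 i); rewrite in_itv.
Qed.

Lemma displaced0 x y : torus n x -> displaced (fun=> 0) (x, y) = x.
Proof.
move=> Tx; apply: eq_from_tnth => i; rewrite tnth_mktuple/= mul0r addr0 wrap_id//.
by rewrite in_itv/=; exact: Tx.
Qed.

Lemma measurable_displaced v : measurable_fun setT (displaced v).
Proof.
apply/measurable_fun_tnthP => i.
rewrite (_ : _ \o _ = fun z : X * X => wrap ((tnth z.1 i : R) + v i * tnth z.2 i)).
  apply: (measurableT_comp (@measurable_wrap R)).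
  apply: measurable_funD; first exact: (measurableT_comp (measurable_tnth i)).
  by apply: measurable_funM => //; exact: (measurableT_comp (measurable_tnth i)).
by apply/funext => z /=; rewrite tnth_mktuple.
Qed.

Variables (f : X -> R) (mf : measurable_fun setT f) (p : R) (p1 : 1 <= p).

Definition displ v z : R := f (displaced v z).

Lemma measurable_displ v : measurable_fun setT (displ v).
Proof. exact: measurableT_comp mf (measurable_displaced v). Qed.

Definition sgn (b : bool) : R := if b then -1 else 1.

Lemma displ_shift w v x y :
  displ v (torus_add x [tuple w i * tnth y i | i < n], y) =
  displ (fun i => v i + w i) (x, y).
Proof.
congr f; apply: eq_from_tnth => i; rewrite !tnth_mktuple wrap_wrapD.
by congr (wrap _); ring.
Qed.

Lemma displ_reflect e v x y :
  displ v (x, reflect_coords e y) = displ (fun i => sgn (e i) * v i) (x, y).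
Proof.
congr f; apply: eq_from_tnth => i; rewrite !tnth_mktuple /=.
by congr (wrap _); rewrite /sgn; case: (e i); ring.
Qed.

Definition abs_powR (G : X * X -> R) z : R := `|G z| `^ p.

Lemma nnmeasurable_abs_powR G : measurable_fun setT G -> nnmeasurable (abs_powR G).
Proof.
move=> mG; split; last by move=> z; exact: powR_ge0.
by apply: (measurableT_comp (measurable_powR p)); exact: measurableT_comp.
Qed.

Local Open Scope ereal_scope.

(** The functional [g] sees the whole family of displaced values, so that differences of two values
    and differences of averages over the cube are treated alike. *)
Lemma torus_int_displ_shift w (g : (('I_n -> R) -> R) -> R) :
  nnmeasurable (fun z => g (displ^~ z)) ->
  nnmeasurable (fun z => g (fun v => displ (fun i => v i + w i)%R z)) ->
  torus_int (fun z => g (fun v => displ (fun i => v i + w i)%R z)) =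
  torus_int (fun z => g (displ^~ z)).
Proof.
pose W (y : X) : X := [tuple (w i * tnth y i)%R | i < n].
pose G z := g (displ^~ z).
have -> : (fun z => g (fun v => displ (fun i => v i + w i)%R z)) =
    (fun z => G (torus_add z.1 (W z.2), z.2)).
  by apply/funext => -[x y]; congr g; apply/funext => v; rewrite displ_shift.
exact: torus_int_shift.
Qed.

Lemma torus_int_displ_reflect e (g : (('I_n -> R) -> R) -> R) :
  nnmeasurable (fun z => g (displ^~ z)) ->
  torus_int (fun z => g (fun v => displ (fun i => sgn (e i) * v i)%R z)) =
  torus_int (fun z => g (displ^~ z)).
Proof.
pose G z := g (displ^~ z).
have -> : (fun z => g (fun v => displ (fun i => sgn (e i) * v i)%R z)) =
    (fun z => G (z.1, reflect_coords e z.2)).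
  by apply/funext => -[x y]; congr g; apply/funext => v; rewrite displ_reflect.
exact: torus_int_reflect.
Qed.

(** Convexity over [r] steps costs [r^(p - 1)], and the [r] equal integrals give the remaining
    factor. The numbers of steps used are 2, 4 and [m]. *)
Lemma torus_int_telescope (B : nat -> X * X -> R) (Q : \bar R) r :
  (forall l, measurable_fun setT (B l)) ->
  (forall l, (l < r)%N -> torus_int (abs_powR (fun z => B l.+1 z - B l z)%R) = Q) ->
  torus_int (abs_powR (fun z => B r z - B 0%N z)%R) <= (r%:R `^ p)%:E * Q.
Proof.
move=> mB hQ.
have mBB l k : measurable_fun setT (fun z => B l z - B k z)%R.
  exact: measurable_funB.
have p0 : (p != 0)%R by rewrite gt_eqF// (lt_le_trans ltr01).
(* For [r = 0] the hypothesis says nothing about [Q], but both sides vanish; otherwise [Q] is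
   nonnegative as an integral. *)
case: r hQ => [|r] hQ.
  rewrite powR0//.
  rewrite mul0e -(@torus_int0 R n) (_ : abs_powR _ = fun=> 0%R)//.
  by apply/funext => z; rewrite /abs_powR subrr normr0 powR0.
pose G (l : 'I_r.+1) := abs_powR (fun z => B l.+1 z - B l z)%R.
have mG l : nnmeasurable (G l) by exact: nnmeasurable_abs_powR.
apply: (@le_trans _ _ (torus_int
    (fun z => r.+1%:R `^ (p - 1) * \sum_(l < r.+1) G l z)%R)).
  apply: torus_int_le; first exact: nnmeasurable_abs_powR.
    by apply: nnmeasurableZ; [exact: powR_ge0|exact: nnmeasurable_sum].
  move=> z; have := @powR_sum_le _ _ (fun l : 'I_r.+1 => B l.+1 z - B l z)%R p p1.
  rewrite card_ord; apply: le_trans; rewrite /abs_powR -(telescope_sumr (B^~ z) (leq0n _)).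
  by rewrite big_mkord.
rewrite torus_intZ ?powR_ge0//; last exact: nnmeasurable_sum.
rewrite torus_int_sum//.
under eq_bigr => l _ do rewrite hQ//.
have Q0 : 0 <= Q by rewrite -(hQ 0%N)//; apply: torus_int_ge0; exact: nnmeasurable_abs_powR.
rewrite sume_cst card_ord muleA -EFinM mulrC mulr_powRB1// (lt_le_trans ltr01)//.
Qed.

End displacement.

Section increments.
Context {R : realType} {n : nat}.
Local Notation L := (measurableTypeR R).
Local Notation X := (n.-tuple L).
Variables (f : X -> R) (mf : measurable_fun setT f) (p : R) (p1 : 1 <= p).
Implicit Types (v w : 'I_n -> R) (e : cube n) (S : {set 'I_n}) (z : X * X).
Local Notation Phi := (displ f).

Local Open Scope ereal_scope.

Definition increment v w := torus_int (abs_powR p (fun z => Phi v z - Phi w z)%R).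

Let mPhi v : measurable_fun setT (Phi v) := measurable_displ mf v.

Lemma nnmeasurable_increment v w : nnmeasurable (abs_powR p (fun z => Phi v z - Phi w z)%R).
Proof. by apply: nnmeasurable_abs_powR; exact: measurable_funB. Qed.

Lemma increment_ge0 v w : 0 <= increment v w.
Proof. exact/torus_int_ge0/nnmeasurable_increment. Qed.

Lemma increment_shift v w u :
  increment (fun i => v i + u i)%R (fun i => w i + u i)%R = increment v w.
Proof.
apply: (torus_int_displ_shift (g := fun F => `|F v - F w| `^ p)%R);
exact: nnmeasurable_increment.
Qed.

Lemma increment_reflect e v w :
  increment (fun i => sgn (e i) * v i)%R (fun i => sgn (e i) * w i)%R = increment v w.
Proof.
apply: (torus_int_displ_reflect e (g := fun F => `|F v - F w| `^ p)%R);
exact: nnmeasurable_increment.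
Qed.

(** By translation in [x] and reflection in [y], an increment depends only on the absolute values of
    the coordinates of [v - w]. *)
Lemma increment_eq e v w v' w' :
  (forall i, v i - w i = sgn (e i) * (v' i - w' i))%R ->
  increment v w = increment v' w'.
Proof.
move=> h; rewrite -(increment_reflect e v' w').
rewrite -(increment_shift v w (fun i => sgn (e i) * w' i - w i)%R).
have -> : (fun i => v i + (sgn (e i) * w' i - w i))%R = (fun i => sgn (e i) * v' i)%R.
  by apply/funext => i; rewrite addrCA h; ring.
have -> : (fun i => w i + (sgn (e i) * w' i - w i))%R = (fun i => sgn (e i) * w' i)%R.
  by apply/funext => i; ring.
by [].
Qed.

Lemma increment_mul_le r v w : (forall i, w i = r%:R * v i)%R ->
  increment w (fun=> 0%R) <= (r%:R `^ p)%:E * increment v (fun=> 0%R).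
Proof.
move=> hw; have -> : w = (fun i => r%:R * v i)%R by apply/funext.
have -> : (fun=> 0%R) = (fun i => 0%:R * v i)%R.
  by apply/funext => i; rewrite mul0r.
apply: (torus_int_telescope p1 (B := fun l => Phi (fun i => l%:R * v i)%R)).
  by move=> l; exact: mPhi.
move=> l _; apply: (increment_eq (e := [ffun=> false])) => i.
by rewrite ffunE /sgn -natr1; ring.
Qed.

(** * Smoothing outside a set of coordinates and transfer from the sign cube *)

Section smoothing.
Local Open Scope ring_scope.

Definition offset S (d : R) (g : cube n) : 'I_n -> R :=
  fun i => if i \in S then 0 else sgn (g i) * d.

Definition smooth S (d : R) v z : R :=
  avg (fun g : cube n => Phi (fun i => v i + offset S d g i) z).

Definition ind S : 'I_n -> R := fun i => if i \in S then 1 else 0.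

Definition axis (d : R) (j : 'I_n) : 'I_n -> R := fun i => if i == j then d else 0.

Lemma measurable_avg (T : finType) (G : T -> X * X -> R) :
  (forall t, measurable_fun setT (G t)) ->
  measurable_fun setT (fun z => avg (G^~ z)).
Proof. by move=> mG; apply: measurable_funM => //; exact: measurable_sum. Qed.

Lemma nnmeasurable_avg (T : finType) (G : T -> X * X -> R) :
  (forall t, nnmeasurable (G t)) -> nnmeasurable (fun z => avg (G^~ z)).
Proof.
move=> hG; split; first by apply: measurable_avg => t; case: (hG t).
by move=> z; apply: avg_ge0 => t; case: (hG t).
Qed.

Lemma measurable_smooth S d v : measurable_fun setT (smooth S d v).
Proof. by apply: measurable_avg => g; exact: mPhi. Qed.

Lemma nnmeasurable_smoothB S d v w :
  nnmeasurable (abs_powR p (fun z => smooth S d v z - smooth S d w z)).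
Proof. by apply: nnmeasurable_abs_powR; apply: measurable_funB; exact: measurable_smooth. Qed.

Lemma torus_int_avg (T : finType) (G : T -> X * X -> R) :
  (forall t, nnmeasurable (G t)) ->
  torus_int (fun z => avg (G^~ z)) =
  ((#|T|%:R^-1)%:E * \sum_t torus_int (G t))%E.
Proof.
move=> hG; rewrite /avg torus_intZ ?invr_ge0//; last exact: nnmeasurable_sum.
by rewrite torus_int_sum.
Qed.

Lemma torus_int_avg_le (T : finType) (G : T -> X * X -> R) (Q : \bar R) :
  (forall t, nnmeasurable (G t)) -> (forall t, torus_int (G t) <= Q)%E -> (0 <= Q)%E ->
  (torus_int (fun z => avg (G^~ z)) <= Q)%E.
Proof.
move=> hG hQ Q0; rewrite torus_int_avg//.
have [T0|T0] := posnP #|T|; first by rewrite T0 invr0 mul0e.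
apply: (@le_trans _ _ ((#|T|%:R^-1)%:E * \sum_(t : T) Q)%E).
  by apply: lee_wpmul2l; [rewrite lee_fin|exact: lee_sum].
by rewrite sume_cst muleA -EFinM mulVf ?mul1e// pnatr_eq0 -lt0n.
Qed.

Lemma torus_int_avg_eq (T : finType) (G : T -> X * X -> R) (Q : \bar R) :
  (0 < #|T|)%N ->
  (forall t, nnmeasurable (G t)) -> (forall t, torus_int (G t) = Q) ->
  torus_int (fun z => avg (G^~ z)) = Q.
Proof.
move=> T0 hG hQ; rewrite torus_int_avg//; under eq_bigr do rewrite hQ.
by rewrite sume_cst muleA -EFinM mulVf ?mul1e// pnatr_eq0 -lt0n.
Qed.

Lemma smooth_shift S d v w u :
  torus_int (abs_powR p (fun z => smooth S d (fun i => v i + u i) z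
                           - smooth S d (fun i => w i + u i) z)) =
  torus_int (abs_powR p (fun z => smooth S d v z - smooth S d w z)).
Proof.
pose g (F : ('I_n -> R) -> R) :=
  `|avg (fun e : cube n => F (fun i => v i + offset S d e i))
    - avg (fun e : cube n => F (fun i => w i + offset S d e i))| `^ p.
have -> : abs_powR p (fun z => smooth S d (fun i => v i + u i) z
                           - smooth S d (fun i => w i + u i) z) =
    (fun z => g (fun v => Phi (fun i => v i + u i) z)).
  apply/funext => z; rewrite /abs_powR /g /smooth.
  by congr (`|_ - _| `^ p); apply: eq_avg => e; congr (Phi _ z);
    apply/funext => i; rewrite addrAC.
apply: (torus_int_displ_shift (f := f) (g := g)).
  exact: (nnmeasurable_smoothB S d v w).
rewrite (_ : (fun z => _) = abs_powR p (fun z => smooth S d (fun i => v i + u i) z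
                           - smooth S d (fun i => w i + u i) z)).
  exact: nnmeasurable_smoothB.
apply/funext => z; rewrite /abs_powR /g /smooth.
by congr (`|_ - _| `^ p); apply: eq_avg => e; congr (Phi _ z);
  apply/funext => i; rewrite addrAC.
Qed.

(** For each sign vector [g], the path from [v] to [v + offset] passes through [u g]. Both halves
    have all coordinates equal to [d] in absolute value, so [increment_eq] gives them the same
    integral; the convexity factor [2^(p - 1)] and the two halves make [2^p]. *)
Lemma smoothing_error S d v :
  (torus_int (abs_powR p (fun z => Phi v z - smooth S (2 * d) v z)%R) <=
   (2 `^ p)%:E * increment (fun=> d)%R (fun=> 0)%R)%E.
Proof.
pose D := increment (fun=> d)%R (fun=> 0).
have D0 : (0 <= D)%E := increment_ge0 _ _.
pose u (g : cube n) i := v i + sgn (g i) * d.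
pose w (g : cube n) i := v i + offset S (2 * d) g i.
pose G g z := 2 `^ (p - 1) * (abs_powR p (fun z => Phi v z - Phi (u g) z) z
     + abs_powR p (fun z => Phi (u g) z - Phi (w g) z) z).
have mG g : nnmeasurable (G g).
  apply: nnmeasurableZ; first exact: powR_ge0.
  by apply: nnmeasurableD; exact: nnmeasurable_increment.
apply: (@le_trans _ _ (torus_int (fun z => avg (G^~ z)))).
  apply: torus_int_le.
  - apply: nnmeasurable_abs_powR; apply: measurable_funB; first exact: mPhi.
    exact: measurable_smooth.
  - exact: nnmeasurable_avg.
  move=> z; rewrite /abs_powR.
  rewrite -[X in X - _](@avg_cst R (cube n)) ?card_cube_gt0// -avgB.
  apply: le_trans (avg_powR _ p1) _; apply: le_avg => g.
  rewrite /G /abs_powR; apply: le_trans _ (powR_add_le _ _ p1).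
  by rewrite addrA subrK.
apply: torus_int_avg_le => //; last by rewrite mule_ge0 ?lee_fin ?powR_ge0.
move=> g; rewrite torus_intZ ?powR_ge0//; last first.
  by apply: nnmeasurableD; exact: nnmeasurable_increment.
rewrite torus_intD; [|exact: nnmeasurable_increment..].
have -> : torus_int (abs_powR p (fun z => Phi v z - Phi (u g) z)) = D.
  apply: (increment_eq (e := [ffun i => ~~ g i])) => i.
  by rewrite ffunE /u /sgn; case: (g i) => /=; ring.
have -> : torus_int (abs_powR p (fun z => Phi (u g) z - Phi (w g) z)) = D.
  apply: (increment_eq (e := [ffun i => if i \in S then g i else ~~ g i])) => i.
  by rewrite ffunE /u /w /offset /sgn; case: (i \in S); case: (g i) => /=; ring.
have -> : (D + D = 2%:E * D)%E.
  by rewrite (_ : 2 = 1 + 1)// EFinD ge0_muleDl ?lee_fin// mul1e.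
by rewrite muleA -EFinM mulrC mulr_powRB1// (lt_le_trans ltr01).
Qed.

(** Each of the [m] steps is translated so as to lead from [- 2 d] to [2 d] on [S]: centred in this
    way, it compares antipodal points of the cube. *)
Lemma smooth_telescope S d m : m%:R * (4 * d) = 1 ->
  (torus_int (abs_powR p (fun z => smooth S (2 * d) (ind S) z - smooth S (2 * d) (fun=> 0) z)%R) <=
   (m%:R `^ p)%:E *
   torus_int (abs_powR p (fun z => smooth S (2 * d) (fun i => 2 * d * ind S i) z
                            - smooth S (2 * d) (fun i => - (2 * d * ind S i)) z)%R))%E.
Proof.
move=> md; pose B l := smooth S (2 * d) (fun i => l%:R * (4 * d * ind S i)).
have -> : smooth S (2 * d) (ind S) = B m.
  by congr smooth; apply/funext => i; rewrite mulrA md mul1r.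
have -> : smooth S (2 * d) (fun=> 0) = B 0%N.
  by congr smooth; apply/funext => i; rewrite mul0r.
apply: (torus_int_telescope p1 (B := B)).
  by move=> l; exact: measurable_smooth.
move=> l _; rewrite -[RHS](smooth_shift _ _ _ _
  (fun i => 2 * d * ind S i + l%:R * (4 * d * ind S i))).
apply: congr1; apply: congr1; apply/funext => z.
by congr (_ - _); rewrite /B; congr smooth; apply/funext => i; rewrite -?natr1; ring.
Qed.

Definition sampled (d : R) z : cube n -> R := fun e => Phi (fun i => sgn (e i) * d) z.

Definition negc e : cube n := [ffun i => ~~ e i].

Lemma negcK : involutive negc.
Proof. by move=> e; apply/ffunP => i; rewrite !ffunE negbK. Qed.

Lemma cond_sampled S d z e :
  cond S (sampled d z) e = smooth S d (fun i => sgn (e i) * (d * ind S i)) z.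
Proof.
apply: eq_avg => g; congr (Phi _ z); apply/funext => i.
by rewrite ffunE /offset /ind; case: (i \in S); ring.
Qed.

Lemma smooth_reflect S d e :
  torus_int (abs_powR p (fun z => smooth S d (fun i => d * ind S i) z
                           - smooth S d (fun i => - (d * ind S i)) z)) =
  torus_int (fun z => `|cond S (sampled d z) e - cond S (sampled d z) (negc e)| `^ p).
Proof.
pose g (F : ('I_n -> R) -> R) :=
  `|avg (fun e : cube n => F (fun i => d * ind S i + offset S d e i))
    - avg (fun e : cube n => F (fun i => - (d * ind S i) + offset S d e i))| `^ p.
have := torus_int_displ_reflect (f := f) e (g := g).
move=> /(_ (nnmeasurable_smoothB S d _ _)) <-; apply: congr1; apply/funext => z.
rewrite /g !cond_sampled /smooth.
(* The reflection by [e] also changes the offsets outside [S]; since these are averaged over all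
   signs, replacing [u] by its product with [e] absorbs the change. *)
pose xorc (u : cube n) : cube n := [ffun i => e i (+) u i].
have xorc_inj : injective xorc.
  by apply: (can_inj (g := xorc)) => u; apply/ffunP => i; rewrite !ffunE addKb.
congr (`|_ - _| `^ p); rewrite -[RHS](avg_reindex _ xorc_inj); apply: eq_avg => u /=;
  congr (Phi _ z); apply/funext => i; rewrite ?ffunE /offset /ind ?ffunE /sgn;
  by case: (i \in S); case: (e i); case: (u i); rewrite /=; ring.
Qed.

Lemma measurable_sampled d e : measurable_fun setT (fun z => sampled d z e).
Proof. exact: mPhi. Qed.

Lemma measurable_cond_sampled S d e :
  measurable_fun setT (fun z => cond S (sampled d z) e).
Proof.
exact (measurable_avg (fun g => measurable_sampled d (splice S e g))).
Qed.

Lemma nnmeasurable_cond S d e :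
  nnmeasurable (fun z => `|cond S (sampled d z) e - avg (sampled d z)| `^ p).
Proof.
apply: nnmeasurable_abs_powR; apply: measurable_funB.
  exact: measurable_cond_sampled.
exact (measurable_avg (fun g => measurable_sampled d g)).
Qed.

(** By [smooth_reflect] the antipodal difference has the same integral for every [e], so it may be
    averaged over the cube. Inserting the mean of the samples then splits it into two terms with
    equal averages, as [negc] permutes the cube. *)
Lemma smooth_cond_le S d :
  (torus_int (abs_powR p (fun z => smooth S d (fun i => d * ind S i) z
                           - smooth S d (fun i => - (d * ind S i)) z)%R) <=
   (2 `^ p)%:E * torus_int (fun z =>
     avg (fun e => `|cond S (sampled d z) e - avg (sampled d z)| `^ p))%R)%E.
Proof.
pose G e z := `|cond S (sampled d z) e - cond S (sampled d z) (negc e)| `^ p.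
have mG e : nnmeasurable (G e).
  by apply: nnmeasurable_abs_powR; apply: measurable_funB; exact: measurable_cond_sampled.
have <- := torus_int_avg_eq (@card_cube_gt0 n) mG (fun e => esym (smooth_reflect S d e)).
have mC : nnmeasurable (fun z =>
    avg (fun e => `|cond S (sampled d z) e - avg (sampled d z)| `^ p)).
  apply: (nnmeasurable_avg
    (G := fun e z => `|cond S (sampled d z) e - avg (sampled d z)| `^ p)) => e.
  exact: nnmeasurable_cond.
rewrite -torus_intZ ?powR_ge0//; apply: torus_int_le.
- exact: nnmeasurable_avg.
- by apply: nnmeasurableZ => //; exact: powR_ge0.
move=> z; set h := sampled d z.
have -> (a : R) : 2 `^ p * a = 2 `^ (p - 1) * (a + a).
  rewrite -(@mulr_powRB1 _ 2 p)// ?(lt_le_trans ltr01)//; ring.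
rewrite -{2}(avg_reindex (fun e => `|cond S h e - avg h| `^ p) (can_inj negcK)).
rewrite -avgD -avgZ; apply: le_avg => e /=.
rewrite /G [`|cond S h (negc e) - _|]distrC.
by apply: le_trans (powR_add_le _ _ p1); rewrite addrA subrK.
Qed.

(** [cube_Xp] is applied for fixed [z] and integrated. Flipping the sign [j] moves the sample by
    [4 d] along coordinate [j], four elementary steps and hence [4^p]; a sample is [2 d] away from
    the undisplaced point in every coordinate, hence [2^p]. The halves in the discrete derivatives
    are simply dropped. *)
Lemma cond_level_le k d : 2 <= p -> (1 <= k <= n)%N ->
  (('C(n, k)%:R^-1)%:E * \sum_(S : {set 'I_n} | #|S| == k) torus_int (fun z =>
     avg (fun e => `|cond S (sampled (2 * d) z) e - avg (sampled (2 * d) z)| `^ p))%R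
   <= (cube_const p * 2 `^ p)%:E * (
     (k%:R / n%:R)%:E * (\sum_(j < n) (4 `^ p)%:E *
        increment (axis d j) (fun=> 0)%R)
   + ((k%:R / n%:R) `^ (p / 2))%:E * ((2 `^ p)%:E * increment (fun=> d)%R (fun=> 0)%R)))%E.
Proof.
move=> p2 hk; set c1 := cube_const p * 2 `^ p; set q := k%:R / n%:R.
have c10 : 0 <= c1 by rewrite mulr_ge0 ?powR_ge0 ?ltW ?cube_const_gt0.
have q0 : 0 <= q by rewrite divr_ge0.
pose GS (S : {set 'I_n}) z := avg (fun e =>
  `|cond S (sampled (2 * d) z) e - avg (sampled (2 * d) z)| `^ p).
have mGS S : nnmeasurable (GS S).
  apply: (nnmeasurable_avg (G := fun e z =>
    `|cond S (sampled (2 * d) z) e - avg (sampled (2 * d) z)| `^ p)) => e.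
  exact: nnmeasurable_cond.
pose Gj (j : 'I_n) (e : cube n) :=
  abs_powR p (fun z => sampled (2 * d) z e - sampled (2 * d) z (flip j e)).
have mGj j e : nnmeasurable (Gj j e) by exact: nnmeasurable_increment.
pose G0 (e : cube n) := abs_powR p (fun z => sampled (2 * d) z e - Phi (fun=> 0) z).
have mG0 e : nnmeasurable (G0 e) by exact: nnmeasurable_increment.
have mA j : nnmeasurable (fun z => avg ((Gj j)^~ z)) by exact: nnmeasurable_avg.
have mA0 : nnmeasurable (fun z => avg (G0^~ z)) by exact: nnmeasurable_avg.
pose RHS z := c1 * (q * (\sum_j avg ((Gj j)^~ z)) + q `^ (p / 2) * avg (G0^~ z)).
have mR1 : nnmeasurable (fun z => q * (\sum_j avg ((Gj j)^~ z))).
  by apply: nnmeasurableZ => //; exact: nnmeasurable_sum.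
have mR2 : nnmeasurable (fun z => q `^ (p / 2) * avg (G0^~ z)).
  by apply: nnmeasurableZ => //; exact: powR_ge0.
apply: (@le_trans _ _ (torus_int RHS)).
  rewrite -torus_int_sum// -torus_intZ ?invr_ge0//; last exact: nnmeasurable_sum.
  apply: torus_int_le.
  - by apply: nnmeasurableZ; rewrite ?invr_ge0//; exact: nnmeasurable_sum.
  - by apply: nnmeasurableZ => //; exact: nnmeasurableD.
  move=> z.
  apply: le_trans (cube_Xp (sampled (2 * d) z) (Phi (fun=> 0) z) p2 hk) _.
  apply: ler_wpM2l => //; apply: lerD => //; apply: ler_wpM2l => //.
  apply: ler_sum => j _; apply: le_avg => e; rewrite /Gj /abs_powR.
  apply: ge0_ler_powR; rewrite ?nnegrE//; first by lra.
  rewrite normrM [`|2^-1|]ger0_norm ?invr_ge0// ler_pdivrMr//.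
  by apply: ler_peMr => //; lra.
rewrite torus_intZ//; last exact: nnmeasurableD.
rewrite torus_intD// (torus_intZ (powR_ge0 _ _))//.
rewrite (torus_intZ q0); last exact: nnmeasurable_sum.
rewrite torus_int_sum//.
apply: lee_wpmul2l; first by rewrite lee_fin.
have inc0 j : (0 <= (4 `^ p)%:E *
    increment (axis d j) (fun=> 0)%R)%E.
  by rewrite mule_ge0 ?increment_ge0// lee_fin powR_ge0.
apply: leeD; (apply: lee_wpmul2l; first by rewrite lee_fin ?powR_ge0).
  apply: lee_sum => j _; apply: torus_int_avg_le => // e.
  apply: le_trans (increment_mul_le (r := 4) (fun i => erefl)).
  rewrite le_eqVlt; apply/orP; left; apply/eqP.
  apply: (increment_eq (e := e)) => i.
  rewrite ffunE /axis /sgn; case: eqP => [->|_]; last by ring.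
  by case: (e j) => /=; ring.
apply: torus_int_avg_le => //; last first.
  by rewrite mule_ge0 ?increment_ge0// lee_fin powR_ge0.
move=> e; apply: le_trans (increment_mul_le (r := 2) (fun i => erefl)).
rewrite le_eqVlt; apply/orP; left; apply/eqP.
by apply: (increment_eq (e := e)) => i; ring.
Qed.

End smoothing.
End increments.

(** * The inequality for real Borel functions *)

Section increments_Xp.
Context {R : realType}.
Implicit Types (p d : R) (n k m : nat).

(** [3^(p - 1)] splits [f (x + y_S) - f x] into two smoothing errors, of constant [2^p] each, and
    one difference of smoothed values. For the latter, [2^p] comes from splitting antipodal
    differences at the mean, [cube_const p * 2^p] from [cube_Xp], and [4^p] from the elementary
    steps. *)
Definition increment_const p : R :=
  3 `^ (p - 1) * (2 * 2 `^ p + 2 `^ p * (cube_const p * 2 `^ p) * 4 `^ p).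

Lemma increment_const_gt0 p : 2 <= p -> 0 < increment_const p.
Proof.
move=> p2; have c0 := cube_const_gt0 p2.
by rewrite mulr_gt0 ?powR_gt0// addr_gt0// !mulr_gt0 ?powR_gt0.
Qed.

Local Notation X n := (n.-tuple (measurableTypeR R)).

Lemma increment_ind_le p n (f : X n -> R) (S : {set 'I_n}) m d :
  1 <= p -> measurable_fun setT f -> m%:R * (4 * d) = 1 ->
  (increment f p (ind S) (fun=> 0)%R <=
   (3 `^ (p - 1))%:E * ((2 * 2 `^ p)%:E * increment f p (fun=> d)%R (fun=> 0)%R +
     (m%:R `^ p * 2 `^ p)%:E * torus_int (fun z =>
       avg (fun e => `|cond S (sampled f (2 * d) z) e - avg (sampled f (2 * d) z)| `^ p))%R))%E.
Proof.
move=> p1 mf md.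
pose A v := smooth f S (2 * d) v.
pose G1 := abs_powR p (fun z => displ f (ind S) z - A (ind S) z).
pose G2 := abs_powR p (fun z => A (ind S) z - A (fun=> 0) z).
pose G3 := abs_powR p (fun z => displ f (fun=> 0) z - A (fun=> 0) z).
have mA v : measurable_fun setT (A v) by exact: measurable_smooth.
have mP v := measurable_displ mf v.
have m1 : nnmeasurable G1 by apply: nnmeasurable_abs_powR; exact: measurable_funB.
have m2 : nnmeasurable G2 by apply: nnmeasurable_abs_powR; exact: measurable_funB.
have m3 : nnmeasurable G3 by apply: nnmeasurable_abs_powR; exact: measurable_funB.
have m12 := nnmeasurableD m1 m2.
have m123 := nnmeasurableD m12 m3.
apply: (@le_trans _ _ (torus_int (fun z => 3 `^ (p - 1) * (G1 z + G2 z + G3 z)))).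
  apply: torus_int_le.
  - exact: nnmeasurable_increment.
  - by apply: nnmeasurableZ => //; exact: powR_ge0.
  move=> z; pose x (i : 'I_3) := nth 0 [:: displ f (ind S) z - A (ind S) z;
    A (ind S) z - A (fun=> 0) z; A (fun=> 0) z - displ f (fun=> 0) z] i.
  have := powR_sum_le x p1; rewrite card_ord !big_ord_recl !big_ord0 /x /= !addr0 => h.
  apply: le_trans (le_trans h _); rewrite /abs_powR /G1 /G2 /G3 /abs_powR.
    by rewrite le_eqVlt; apply/orP; left; apply/eqP; congr (`|_| `^ p); ring.
  by rewrite [`|A _ z - displ f (fun=> 0) z|]distrC addrA.
rewrite torus_intZ ?powR_ge0//.
apply: lee_wpmul2l; first by rewrite lee_fin powR_ge0.
rewrite torus_intD// torus_intD//.
have D0 := increment_ge0 mf p (fun=> d) (fun=> 0).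
set D := increment f p _ _ in D0 *; set T := torus_int _.
have -> : ((2 * 2 `^ p)%:E * D = (2 `^ p)%:E * D + (2 `^ p)%:E * D)%E.
  by rewrite mulr_natl mulr2n EFinD ge0_muleDl// lee_fin powR_ge0.
rewrite addeAC; apply: leeD; first by apply: leeD; exact: smoothing_error.
apply: le_trans (smooth_telescope mf p1 S md) _.
rewrite EFinM -muleA; apply: lee_wpmul2l; first by rewrite lee_fin powR_ge0.
exact: smooth_cond_le.
Qed.

Lemma increments_Xp p n k m (f : X n -> R) :
  2 <= p -> (1 <= k <= n)%N -> Num.sqrt (n%:R / k%:R : R) <= m%:R ->
  measurable_fun setT f ->
  (('C(n, k)%:R^-1)%:E *
     \sum_(S : {set 'I_n} | #|S| == k) increment f p (ind S) (fun=> 0)%R <=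
   (increment_const p * m%:R `^ p)%:E *
     ((k%:R / n%:R)%:E * (\sum_(j < n)
        increment f p (axis (4 * m%:R)^-1 j)%R (fun=> 0)%R)
      + ((k%:R / n%:R) `^ (p / 2))%:E * increment f p (fun=> (4 * m%:R)^-1)%R (fun=> 0)%R))%E.
Proof.
move=> p2 hk hm mf; have p1 : 1 <= p by lra.
have /andP[k0 kn] := hk.
have kR : (0 : R) < k%:R by rewrite ltr0n.
have nR : (0 : R) < n%:R by rewrite ltr0n (leq_trans k0).
have m1 : 1 <= m%:R :> R.
  apply: le_trans hm; rewrite -[leLHS]sqrtr1 ler_wsqrtr// ler_pdivlMr// mul1r ler_nat//.
have m0 : 0 < m%:R :> R by lra.
set q : R := k%:R / n%:R; have q0 : 0 < q by rewrite divr_gt0.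
set d : R := (4 * m%:R)^-1.
have md : m%:R * (4 * d) = 1 by rewrite /d; field; rewrite gt_eqF.
have mq : 1 <= m%:R `^ p * q `^ (p / 2).
  rewrite -(@sqr_powR _ m%:R p) ?ler0n// -powRM ?sqr_ge0 ?(ltW q0)//.
  apply: (@le_trans _ _ (1 `^ (p / 2))); first by rewrite powR1.
  have mq2 : 1 <= m%:R ^+ 2 * q.
    have : n%:R / k%:R <= m%:R ^+ 2 :> R.
      by rewrite -[leLHS]sqr_sqrtr ?divr_ge0// lerXn2r ?nnegrE ?sqrtr_ge0// ltW.
    rewrite ler_pdivrMr// => h; rewrite /q mulrA ler_pdivlMr// mul1r//.
  by apply: ge0_ler_powR; rewrite ?nnegrE//; lra.
set E := (\sum_(j < n) _)%E.
set D := increment f p (fun=> d) _.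
have D0 : (0 <= D)%E := increment_ge0 mf p _ _.
have E0 : (0 <= E)%E by apply: sume_ge0 => j _; exact: increment_ge0.
pose T (S : {set 'I_n}) := torus_int (fun z =>
  avg (fun e => `|cond S (sampled f (2 * d) z) e - avg (sampled f (2 * d) z)| `^ p)).
have T0 S : (0 <= T S)%E.
  apply: torus_int_ge0; apply: (nnmeasurable_avg (G := fun e z =>
    `|cond S (sampled f (2 * d) z) e - avg (sampled f (2 * d) z)| `^ p)) => e.
  exact: nnmeasurable_cond.
have hT := cond_level_le mf p1 d p2 hk.
set c0 := cube_const p * 2 `^ p in hT *.
have c00 : 0 < c0 by rewrite mulr_gt0 ?powR_gt0// cube_const_gt0.
set c3 : R := 3 `^ (p - 1).
have c30 : 0 < c3 by rewrite powR_gt0.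
have C0 : 0 < 'C(n, k)%:R :> R by rewrite ltr0n bin_gt0.
have CC : #|[pred S : {set 'I_n} | #|S| == k]| = 'C(n, k).
  by rewrite -[n in RHS]card_ord -card_draws; apply: eq_card => S; rewrite !inE.
have avgT (Q : {set 'I_n} -> \bar R) (a b : R) : 0 <= a -> 0 <= b ->
   (forall S, (0 <= Q S)%E) ->
   (('C(n, k)%:R^-1)%:E * (\sum_(S : {set 'I_n} | #|S| == k) (a%:E * D + b%:E * Q S))
    = a%:E * D + b%:E * (('C(n, k)%:R^-1)%:E * \sum_(S : {set 'I_n} | #|S| == k) Q S))%E.
  move=> a0 b0 Q0; rewrite big_split /= ge0_muleDr; last 2 first.
  - by apply: sume_ge0 => S _; rewrite mule_ge0.
  - by apply: sume_ge0 => S _; rewrite mule_ge0.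
  congr (_ + _)%E; last first.
    by rewrite -ge0_sume_distrr// muleCA.
  by rewrite sume_cst CC muleA -EFinM mulVf ?mul1e// gt_eqF.
have le1 : (('C(n, k)%:R^-1)%:E *
     \sum_(S : {set 'I_n} | #|S| == k) increment f p (ind S) (fun=> 0)%R <=
     (c3 * (2 * 2 `^ p))%:E * D + (c3 * (m%:R `^ p * 2 `^ p))%:E *
       (('C(n, k)%:R^-1)%:E * \sum_(S : {set 'I_n} | #|S| == k) T S))%E.
  rewrite -avgT//; last 2 first.
  - by rewrite mulr_ge0 ?(ltW c30)// mulr_ge0 ?powR_ge0.
  - by rewrite mulr_ge0 ?(ltW c30)// mulr_ge0 ?powR_ge0.
  apply: lee_wpmul2l; first by rewrite lee_fin invr_ge0.
  apply: lee_sum => S _; apply: le_trans (increment_ind_le S p1 mf md) _.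
  rewrite ge0_muleDr; last 2 first.
  - by rewrite mule_ge0// lee_fin mulr_ge0 ?powR_ge0.
  - apply: mule_ge0; last exact: T0.
    by rewrite lee_fin; exact: mulr_ge0 (powR_ge0 _ _) (powR_ge0 _ _).
  by rewrite !muleA -!EFinM.
apply: le_trans le1 _.
have hT' : (('C(n, k)%:R^-1)%:E * \sum_(S : {set 'I_n} | #|S| == k) T S <=
    (c0 * q * 4 `^ p)%:E * E + (c0 * q `^ (p / 2) * 2 `^ p)%:E * D)%E.
  apply: le_trans hT _; rewrite -/D -ge0_sume_distrr; last first.
    by move=> j _; exact: increment_ge0.
  rewrite -/E ge0_muleDr; last 2 first.
  - by rewrite mule_ge0 ?lee_fin ?(ltW q0)// mule_ge0// lee_fin powR_ge0.
  - by rewrite mule_ge0 ?lee_fin ?powR_ge0// mule_ge0// lee_fin powR_ge0.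
  by rewrite !muleA -!EFinM.
have cm0 : 0 <= c3 * (m%:R `^ p * 2 `^ p).
  by rewrite mulr_ge0 ?(ltW c30)// mulr_ge0 ?powR_ge0.
apply: le_trans (leeD (lexx _) (lee_wpmul2l _ hT')) _; first by rewrite lee_fin.
have qp0 : 0 < q `^ (p / 2) by rewrite powR_gt0.
have P2 : 0 < 2 `^ p :> R by rewrite powR_gt0.
have P24 : 2 `^ p <= 4 `^ p :> R.
  by apply: ge0_ler_powR; rewrite ?nnegrE//; lra.
have Pm : 0 < m%:R `^ p :> R by rewrite powR_gt0.
have K0 := increment_const_gt0 p2.
have KE : increment_const p = c3 * (2 * 2 `^ p + 2 `^ p * c0 * 4 `^ p) by [].
clearbody D E c0 c3 q.
rewrite ge0_muleDr; last 2 first.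
- by rewrite mule_ge0// lee_fin !mulr_ge0 ?powR_ge0 ?ltW.
- by rewrite mule_ge0// lee_fin !mulr_ge0 ?powR_ge0 ?ltW.
rewrite [leRHS]ge0_muleDr; last 2 first.
- by rewrite mule_ge0// lee_fin ltW.
- by rewrite mule_ge0// lee_fin ltW.
rewrite !muleA -!EFinM addeCA -ge0_muleDl; last 2 first.
- by rewrite lee_fin mulr_ge0 ?(ltW c30)// mulr_ge0 ?powR_ge0.
- by rewrite lee_fin mulr_ge0// !mulr_ge0 ?powR_ge0 ?ltW.
rewrite -EFinD; apply: leeD; apply: lee_wpmul2r => //; rewrite lee_fin.
  rewrite KE mulrDr !mulrDl.
  rewrite -[leLHS]add0r; apply: lerD.
    by rewrite !mulr_ge0 ?ltW.
  by rewrite le_eqVlt; apply/orP; left; apply/eqP; ring.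
(* In the coefficient of [D], the smoothing errors carry no power of [m] and are enlarged by [mq];
   the cube term only needs [2^p <= 4^p]. *)
rewrite KE mulrDr !mulrDl; apply: lerD.
  rewrite -[leRHS]mulrA; apply: ler_peMr => //.
  by rewrite mulr_ge0 ?(ltW c30)// mulr_ge0 ?powR_ge0.
have -> : c3 * (m%:R `^ p * 2 `^ p) * (c0 * q `^ (p / 2) * 2 `^ p) =
  (c3 * m%:R `^ p * 2 `^ p * c0 * q `^ (p / 2)) * 2 `^ p by ring.
have -> : c3 * (2 `^ p * c0 * 4 `^ p) * m%:R `^ p * q `^ (p / 2) =
  (c3 * m%:R `^ p * 2 `^ p * c0 * q `^ (p / 2)) * 4 `^ p by ring.
by apply: ler_wpM2l P24; rewrite !mulr_ge0 ?ltW.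
Qed.

End increments_Xp.

(** * From Lebesgue measurable to Borel functions *)

Section integral_off_null.
Local Open Scope ereal_scope.
Context d (T : measurableType d) (R : realType) (mu : {measure set T -> \bar R}).
Import HBNNSimple.

(** [f] and [g] need not be measurable, so the comparison is made on the simple functions below [f]:
    set to zero on [N], they keep their integral and lie below [g]. *)
Let integral_le_off_null (N : set T) (f g : T -> \bar R) :
  measurable N -> mu N = 0 -> (forall x, 0 <= f x) -> (forall x, 0 <= g x) ->
  (forall x, ~ N x -> f x = g x) -> \int[mu]_x f x <= \int[mu]_x g x.
Proof.
move=> mN N0 f0 g0 fg; rewrite !ge0_integralTE//.
apply: ge_ereal_sup => _ [h hf <-].
pose h' := proj_nnsfun h (measurableC mN).
have h'E x : h' x = (h \_ (~` N)) x by rewrite (mrestrict h (measurableC mN)).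
have -> : sintegral mu h = sintegral mu h'.
  rewrite -!integralT_nnsfun; apply: ge0_ae_eq_integral => //.
  - by apply/measurable_EFinP; exact: measurable_funP.
  - by apply/measurable_EFinP; exact: measurable_funP.
  - by move=> x _; rewrite lee_fin.
  - by move=> x _; rewrite lee_fin.
  exists N; split => // x /= /not_implyP[_]; apply: contra_notP => xN.
  by rewrite -[(h x * _)%R]/(h' x) h'E patchE mem_set.
apply: ereal_sup_ubound; exists h' => // x.
rewrite h'E patchE; case: ifPn => [/set_mem xN|_]; last exact: g0.
by rewrite -fg//; exact: hf.
Qed.

Lemma ge0_eq_integral_off_null (D N : set T) (f g : T -> \bar R) :
  measurable N -> mu N = 0 ->
  (forall x, D x -> 0 <= f x) -> (forall x, D x -> 0 <= g x) ->
  (forall x, D x -> ~ N x -> f x = g x) ->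
  \int[mu]_(x in D) f x = \int[mu]_(x in D) g x.
Proof.
move=> mN N0 f0 g0 fg; rewrite [LHS]integral_mkcond [RHS]integral_mkcond.
have fg' x : ~ N x -> (f \_ D) x = (g \_ D) x.
  by move=> xN; rewrite !patchE; case: ifPn => // /set_mem Dx; exact: fg.
apply/eqP; rewrite eq_le; apply/andP; split; apply: (integral_le_off_null mN N0).
- exact: erestrict_ge0.
- exact: erestrict_ge0.
- exact: fg'.
- exact: erestrict_ge0.
- exact: erestrict_ge0.
- by move=> x /fg' ->.
Qed.

End integral_off_null.

Section caratheodory_null.
Local Open Scope ereal_scope.
Context d (T : measurableType d) (R : realType) (mu : {measure set T -> \bar R}).
Local Notation mustar := (mu^*)%mu.

(** The hull is an intersection of countable covers whose total measures exceed the outer measure by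
    less than [1 / (k + 1)]. *)
Lemma outer_measure_hull (A : set T) : mustar A < +oo ->
  exists G, [/\ measurable G, A `<=` G & mu G = mustar A].
Proof.
move=> Aoo.
have inv0 k : (0 < k.+1%:R^-1 :> R)%R by rewrite invr_gt0.
have cover (s : R) : (0 < s)%R -> exists2 F, measurable_cover A F &
    \sum_(0 <= k <oo) mu (F k) < mustar A + s%:E.
  move=> s0; have : mustar A \is a fin_num by rewrite ge0_fin_numE// outer_measure_ge0.
  by move/lb_ereal_inf_adherent => /(_ _ s0)[_/= [F AF] <-] ?; exists F.
pose F k := projT1 (cid2 (cover _ (inv0 k))).
have mF k : measurable_cover A (F k) by rewrite /F; case: cid2.
have F_lt k : \sum_(0 <= i <oo) mu (F k i) < mustar A + k.+1%:R^-1%:E.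
  by rewrite /F; case: cid2.
pose U k := \bigcup_i F k i.
have mU k : measurable (U k).
  by apply: bigcupT_measurable => i; have [/(_ i)] := mF k.
have mG : measurable (\bigcap_k U k) by apply: bigcapT_measurable.
have AG : A `<=` \bigcap_k U k by move=> x Ax k _; case: (mF k) => _; exact.
exists (\bigcap_k U k); split => //.
apply/eqP; rewrite eq_le; apply/andP; split; last first.
  by rewrite -(measurable_mu_extE mu mG); exact: le_outer_measure.
apply/lee_addgt0Pr => _/posnumP[e]; near \oo => k.
apply: (@le_trans _ _ (mu (U k))).
  by apply: le_measure; rewrite ?inE//; exact: bigcap_inf.
apply: (@le_trans _ _ (\sum_(0 <= i <oo) mu (F k i))).
  by apply: measure_sigma_subadditive => // i; case: (mF k).
rewrite (le_trans (ltW (F_lt k)))// leeD// lee_fin ltW//.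
by near: k; apply: near_infty_natSinv_lt.
Unshelve. all: by end_near. Qed.

(** Splitting the hull [G] of [A] by the Caratheodory condition and cancelling the finite outer
    measure of [A] shows that the excess of [G] over [A] is null; [N] is a hull of that excess. *)
Lemma caratheodory_measurable_off_null (A : set T) :
  mustar.-cara.-measurable A -> mustar A < +oo ->
  exists B N, [/\ measurable B, measurable N, mu N = 0 & A `\` N = B `\` N].
Proof.
move=> mA Aoo; have [G [mG AG GA]] := outer_measure_hull Aoo.
have GA0 : mustar (G `\` A) = 0.
  have h : mustar G = mustar (G `&` A) + mustar (G `&` ~` A) := mA G.
  rewrite (measurable_mu_extE mu mG) GA (setIidr AG) in h.
  have fA : mustar A \is a fin_num by rewrite ge0_fin_numE// outer_measure_ge0.
  rewrite setDE; move: fA h; case: (mustar A) => //= a _.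
  case: (mustar _) => // b; rewrite -EFinD => -[]; rewrite -[X in X = _]addr0.
  by move=> /addrI <-.
have [|N [mN AN N0]] := @outer_measure_hull (G `\` A); first by rewrite GA0.
exists G, N; split => //; first by rewrite N0.
apply/seteqP; split => x [xA xN]; split => //; first exact: AG.
by apply: contrapT => nA; apply: xN; exact: AN.
Qed.

End caratheodory_null.

Section completion.
Context {R : realType} {n : nat}.
Local Notation L := (measurableTypeR R).
Local Notation X := (n.-tuple L).
Local Notation m := (power_measure (@lebesgue_measure R) n).
Local Notation c := (@lebesgue_measure_tuple R n).
Local Open Scope ereal_scope.

Lemma measurable_lebesgue_space (A : set X) :
  measurable A -> measurable (A : set (@lebesgue_space R n)).
Proof. by move=> mA; apply: sub_caratheodory; exact: sub_sigma_algebra. Qed.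

Lemma lebesgue_measure_tupleE (A : set X) : measurable A -> c A = m A.
Proof. exact: measurable_mu_extE. Qed.

(** The identity is measurable from the Lebesgue to the Borel structure and pushes the completed
    measure forward to the Borel one. *)
Lemma ge0_integral_lebesgue_tuple (D : set X) (g : X -> \bar R) :
  measurable D -> measurable_fun D g -> (forall x, D x -> 0 <= g x) ->
  \int[c]_(x in D) g x = \int[m]_(x in D) g x.
Proof.
move=> mD mg g0.
have mid : measurable_fun setT (fun x : @lebesgue_space R n => x : X).
  by move=> _ A mA; rewrite setTI; exact: measurable_lebesgue_space.
have := @ge0_integral_pushforward _ _ _ _ _ _ mid c D g mD mg.
move=> /(_ _)/esym ->; last by move=> x /set_mem; exact: g0.
by apply: eq_measure_integral => A mA _; exact: lebesgue_measure_tupleE.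
Qed.

End completion.

Lemma integral_torus1 {R : realType} n :
  (\int[power_measure (@lebesgue_measure R) n]_(x in torus n) 1 = 1)%E.
Proof.
rewrite torusE; elim: n => [|n IH].
  rewrite integral_cst//=; last exact: measurable_box.
  rewrite mul1e diracE mem_set//; by case.
rewrite integral_box_cons//; under eq_integral do rewrite IH.
rewrite integral_cst//= lebesgue_measure_itv/= mul1e lte_fin.
by rewrite ifT -?EFinB; [congr EFin|]; lra.
Qed.

Lemma power_measure_torus {R : realType} n :
  power_measure (@lebesgue_measure R) n (torus n) = 1%E.
Proof.
have := @integral_torus1 R n; rewrite integral_cst ?mul1e//.
exact: measurable_torus.
Qed.

Section borel_version.
Context {R : realType} {n : nat}.
Local Notation L := (measurableTypeR R).
Local Notation X := (n.-tuple L).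
Local Notation m := (power_measure (@lebesgue_measure R) n).

(** [N] collects the exceptional sets of the superlevel sets at rational heights. Quantifying over
    the larger sets [N'] allows the real and imaginary parts to be cut off on one common null
    set. *)
Lemma lebesgue_measurable_off_null (f : X -> R) :
  measurable_fun (torus n : set (@lebesgue_space R n)) f ->
  exists N : set X, [/\ measurable N, m N = 0%E &
    forall N' : set X, measurable N' -> N `<=` N' ->
    measurable_fun [set: X] (f \_ (torus n `\` N'))].
Proof.
move=> mf; have mT := @measurable_torus R n.
pose A (q : rat) : set X := torus n `&` f @^-1` `]ratr q, +oo[%classic.
have mA q : (m^*)%mu.-cara.-measurable (A q).
  apply: mf; first exact: measurable_lebesgue_space.
  exact: measurable_itv.
have Aoo q : ((m^*)%mu (A q) < +oo)%E.
  apply: (@le_lt_trans _ _ ((m^*)%mu (torus n))).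
    by apply: le_outer_measure; exact: subIsetl.
  have -> : (m^*)%mu (torus n) = m (torus n) by exact: measurable_mu_extE.
  by rewrite power_measure_torus ltry.
pose B q := projT1 (cid (caratheodory_measurable_off_null (mA q) (Aoo q))).
pose M q := projT1 (cid (projT2 (cid (caratheodory_measurable_off_null (mA q) (Aoo q))))).
have BM q : [/\ measurable (B q), measurable (M q), m (M q) = 0%E & A q `\` M q = B q `\` M q].
  by rewrite /B /M; case: cid => ? /= ?; case: cid.
pose M' k := if unpickle k is Some q then M q else set0.
have mM' k : measurable (M' k) by rewrite /M'; case: unpickle => // q; case: (BM q).
exists (\bigcup_k M' k); split.
- exact: bigcupT_measurable.
- apply: measure_negligible; first exact: bigcupT_measurable.
  apply: negligible_bigcup => k; apply/negligibleP => //.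
  by rewrite /M'; case: unpickle => [q|]; [case: (BM q)|rewrite measure0].
move=> N' mN' NN' _; apply: (measurability _ (RGenOInfty.measurableE R)) => //.
move=> _ [_ [r ->] <-]; rewrite setTI.
have AB q : A q `\` N' = B q `\` N'.
  have [_ _ _ /seteqP[AB BA]] := BM q.
  have M'q : M' (pickle q) = M q by rewrite /M' pickleK.
  have MN' : M q `<=` N'.
    by move=> x Mx; apply: NN'; exists (pickle q); [exact: Logic.I|rewrite M'q].
  apply/seteqP; split => x [xA xN]; split => //.
    by apply: (AB x _).1; split => // /MN'.
  by apply: (BA x _).1; split => // /MN'.
(* A real height [r] is approached by rationals above it; where the function is cut off its value 0
   exceeds [r] exactly when [r < 0]. *)
have -> : (f \_ (torus n `\` N')) @^-1` `]r, +oo[%classic =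
   (\bigcup_(q : rat) (if r < ratr q then B q `\` N' else set0)) `|`
   (if r < 0 then ~` (torus n `\` N') else set0).
  apply/seteqP; split => x /=.
    rewrite patchE in_itv/= andbT; case: ifPn => [/set_mem[Tx Nx] rf|xD r0].
      left; have /rat_in_itvoo[q] := rf; rewrite in_itv/= => /andP[rq qf].
      by exists q => //; rewrite rq -AB; split => //; split => //=; rewrite in_itv/= qf.
    by right; rewrite r0 => TN; move/negP: xD; apply; exact: mem_set.
  rewrite patchE in_itv/= andbT => -[[q _]|].
    case: ifPn => // rq; rewrite -AB => -[[Tx]] /=; rewrite in_itv/= andbT => qf Nx.
    by rewrite mem_set//; exact: lt_trans qf.
  by case: ifPn => // r0 nTN; rewrite memNset.
apply: measurableU; last first.
  by case: ifP => // _; apply: measurableC; exact: measurableD.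
apply: bigcupT_measurable_rat => q; case: ifP => // _.
by apply: measurableD => //; case: (BM q).
Qed.

End borel_version.

Section completed_torus_integral.
Context {R : realType} {n : nat}.
Local Notation L := (measurableTypeR R).
Local Notation X := (n.-tuple L).
Local Notation m := (power_measure (@lebesgue_measure R) n).
Local Notation c := (@lebesgue_measure_tuple R n).

(** Translation invariance removes the displacement [v]; what remains is the indicator of [N] at [x]
    itself. *)
Lemma torus_int_displ_null (N : set X) v : measurable N -> m N = 0%E ->
  torus_int (displ (\1_N : X -> R) v) = 0%E.
Proof.
move=> mN N0.
have m1 : measurable_fun setT (\1_N : X -> R) by exact: measurable_indic.
have mnn u : nnmeasurable (displ (\1_N : X -> R) u).
  by split; [exact: measurable_displ|move=> z; rewrite /displ indicE].
pose g (F : ('I_n -> R) -> R) := F (fun=> 0).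
have -> : displ (\1_N : X -> R) v =
    (fun z => g (fun u => displ (\1_N : X -> R) (fun i => u i + v i) z)).
  apply/funext => z; rewrite /g; congr (displ _ _ z).
  by apply/funext => i; rewrite add0r.
rewrite torus_int_displ_shift; [|exact: mnn|exact: mnn].
rewrite /torus_int (ge0_eq_integral_off_null (N := N) (g := fun=> 0%E))//.
- by rewrite integral0.
- by move=> x _; apply: integral_ge0 => y _; rewrite lee_fin; case: (mnn (fun=> 0)).
move=> x Tx Nx; apply: integral0_eq => y _.
rewrite /g /displ displaced0//.
by rewrite indicE memNset.
Qed.

Let null_section (F : X -> \bar R) : measurable_fun (torus n : set X) F ->
  (forall x, torus n x -> (0 <= F x)%E) -> (\int[m]_(x in torus n) F x = 0)%E ->
  exists M : set X, [/\ measurable M, m M = 0%E & forall x, torus n x -> ~ M x -> F x = 0%E].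
Proof.
move=> mF F0 int0.
have := (ae_eq_integral_abs m (@measurable_torus R n) mF).1.
rewrite (eq_integral F); last by move=> x /set_mem Tx; rewrite gee0_abs//; exact: F0.
move=> /(_ int0)[M [mM M0 sub]]; exists M; split => // x Tx Mx.
apply: contrapT => Fx; apply: Mx; apply: sub => /= h; exact/Fx/h.
Qed.

(* The inner and outer integrands of the left-hand side may fail to be
   measurable; they are only compared with Borel ones off null sets. *)
Lemma completed_torus_int (N : set X) (J : finType) (v : J -> 'I_n -> R)
    (H : X -> X -> R) (G : X * X -> R) :
  measurable N -> m N = 0%E -> nnmeasurable G -> (forall x y, 0 <= H x y) ->
  (forall x y, torus n x -> torus n y -> ~ N x ->
     (forall j, ~ N (displaced (v j) (x, y))) -> H x y = G (x, y)) ->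
  (\int[c]_(x in torus n) \int[c]_(y in torus n) (H x y)%:E)%E = torus_int G.
Proof.
move=> mN N0 hG H0 HG; have [mG G0] := hG; have mT := @measurable_torus R n.
(* [F] counts the displaced points that fall into [N]. Its integral is zero, so off a null set [M]
   of [x] its integral in [y] vanishes. *)
pose F z := \sum_j displ (\1_N : X -> R) (v j) z.
have hFj j : nnmeasurable (displ (\1_N : X -> R) (v j)).
  split; last by move=> z; rewrite /displ indicE.
  by apply: measurable_displ; exact: measurable_indic.
have hF : nnmeasurable F by exact: nnmeasurable_sum.
have F0 : torus_int F = 0%E.
  by rewrite torus_int_sum// big1// => j _; exact: torus_int_displ_null.
have [M [mM M0 FM]] : exists M : set X, [/\ measurable M, m M = 0%E &
    forall x, torus n x -> ~ M x -> (\int[m]_(y in torus n) (F (x, y))%:E = 0)%E].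
  apply: null_section => //; first exact: measurable_marginal.
  by move=> x _; apply: integral_ge0 => y _; rewrite lee_fin; case: hF.
have cnull (A : set X) : measurable A -> m A = 0%E ->
    measurable (A : set (@lebesgue_space R n)) /\ c A = 0%E.
  move=> mA A0; split; first exact: measurable_lebesgue_space.
  by rewrite -A0; exact: lebesgue_measure_tupleE.
have NM0 : m (N `|` M) = 0%E by rewrite null_set_setU.
have [mNM cNM] := cnull _ (measurableU _ _ mN mM) NM0.
transitivity (\int[c]_(x in torus n) \int[m]_(y in torus n) (G (x, y))%:E)%E; last first.
  apply: ge0_integral_lebesgue_tuple => //; first exact: measurable_marginal.
  by move=> x _; apply: integral_ge0 => y _; rewrite lee_fin.
apply: (ge0_eq_integral_off_null mNM cNM).
- by move=> x _; apply: integral_ge0 => y _; rewrite lee_fin.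
- by move=> x _; apply: integral_ge0 => y _; rewrite lee_fin.
move=> x Tx /not_orP[Nx Mx].
(* For such an [x], the [y] for which some displaced point lies in [N] are contained in the null set
   [K], which depends on [x]. *)
have [||K [mK K0 FK]] := null_section _ _ (FM x Tx Mx).
- exact: measurable_section.
- by move=> y _; rewrite lee_fin; case: hF.
have [mK' cK] := cnull _ mK K0.
transitivity (\int[c]_(y in torus n) (G (x, y))%:E)%E; last first.
  apply: ge0_integral_lebesgue_tuple => //; first exact: measurable_section.
  by move=> y _; rewrite lee_fin.
apply: (ge0_eq_integral_off_null mK' cK).
- by move=> y _; rewrite lee_fin.
- by move=> y _; rewrite lee_fin.
move=> y Ty Ky; congr EFin; apply: HG => // j Nj.
have := FK y Ty Ky => -[] /eqP; rewrite psumr_eq0; last first.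
  by move=> i _; case: (hFj i).
move=> /allP/(_ j); rewrite mem_index_enum => /(_ isT)/=.
rewrite /displ indicE mem_set//.
by rewrite oner_eq0.
Qed.

End completed_torus_integral.

(** * Complex values through real and imaginary parts *)

Section complex_increments.
Context {R : realType} {n : nat}.
Local Notation L := (measurableTypeR R).
Local Notation X := (n.-tuple L).
Implicit Types (p : R) (f : X -> R[i]) (v : 'I_n -> R).

Lemma normc_powR (z : R[i]) p :
  normc z `^ p = (complex.Re z ^+ 2 + complex.Im z ^+ 2) `^ (p / 2).
Proof.
case: z => a b /=; rewrite -(@sqr_powR _ (Num.sqrt _)) ?sqrtr_ge0// sqr_sqrtr//.
by rewrite addr_ge0 ?sqr_ge0.
Qed.

(** The [p]-th power of the modulus of [a + i b]. *)
Definition sumsq_powR p (a b : R) : R := (a ^+ 2 + b ^+ 2) `^ (p / 2).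

Lemma le_sumsq_powR p a b : 0 <= p -> `|a| `^ p <= sumsq_powR p a b.
Proof.
move=> p0; rewrite -(sqr_powR _ (normr_ge0 a)) real_normK ?num_real//.
apply: ge0_ler_powR; rewrite ?nnegrE ?addr_ge0 ?sqr_ge0 ?divr_ge0//.
by rewrite lerDl sqr_ge0.
Qed.

Lemma sumsq_powRC p a b : sumsq_powR p a b = sumsq_powR p b a.
Proof. by rewrite /sumsq_powR addrC. Qed.

Lemma sumsq_powR_le p a b : 1 <= p ->
  sumsq_powR p a b <= 2 `^ (p - 1) * (`|a| `^ p + `|b| `^ p).
Proof.
move=> p1; have := @powR_add_le _ `|a| `|b| p p1; rewrite !normr_id.
apply: le_trans; rewrite -(sqr_powR _ (normr_ge0 _)).
apply: ge0_ler_powR; rewrite ?nnegrE ?addr_ge0 ?sqr_ge0 ?divr_ge0//; first by lra.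
rewrite (ger0_norm (addr_ge0 (normr_ge0 a) (normr_ge0 b))) sqrrD.
rewrite !real_normK ?num_real// addrAC lerDl mulrn_wge0// mulr_ge0//.
Qed.

Variables (f1 f2 : X -> R) (mf1 : measurable_fun setT f1) (mf2 : measurable_fun setT f2).

Definition complex_incr p v z : R :=
  sumsq_powR p (displ f1 v z - displ f1 (fun=> 0) z) (displ f2 v z - displ f2 (fun=> 0) z).

Lemma nnmeasurable_complex_incr p v : nnmeasurable (complex_incr p v).
Proof.
split; last by move=> z; exact: powR_ge0.
have md1 u := measurable_displ mf1 u; have md2 u := measurable_displ mf2 u.
apply: (measurableT_comp (measurable_powR (p / 2))).
by apply: measurable_funD; apply: measurable_funX; exact: measurable_funB.
Qed.

Lemma complex_incr_le p v : 1 <= p ->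
  (torus_int (complex_incr p v) <= (2 `^ (p - 1))%:E *
    (increment f1 p v (fun=> 0)%R + increment f2 p v (fun=> 0)%R))%E.
Proof.
move=> p1.
have i1 := nnmeasurable_increment mf1 p v (fun=> 0).
have i2 := nnmeasurable_increment mf2 p v (fun=> 0).
rewrite /increment -torus_intD// -torus_intZ ?powR_ge0//; last exact: nnmeasurableD.
apply: torus_int_le.
- exact: nnmeasurable_complex_incr.
- by apply: nnmeasurableZ; [exact: powR_ge0|exact: nnmeasurableD].
- by move=> z; exact: sumsq_powR_le.
Qed.

End complex_increments.

Section displaced_points.
Context {R : realType} {n : nat}.
Local Notation X := (n.-tuple (measurableTypeR R)).
Implicit Types (x y : X).

Lemma torus_add_restr (S : {set 'I_n}) x y :
  torus_add x (tuple_restr S y) = displaced (ind S) (x, y).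
Proof.
apply: eq_from_tnth => i; rewrite !tnth_mktuple /ind /=.
by case: (i \in S); rewrite ?mul1r ?mul0r.
Qed.

Lemma torus_add_scale_axis (d : R) (j : 'I_n) x y :
  torus_add x (tuple_scale d (tuple_restr [set j]%SET y)) =
  displaced (axis d j) (x, y).
Proof.
apply: eq_from_tnth => i; rewrite !tnth_mktuple /axis /= finset.inE.
by case: eqP => _; rewrite ?mulr0 ?mul0r.
Qed.

Lemma torus_add_scale (d : R) x y :
  torus_add x (tuple_scale d y) = displaced (fun=> d) (x, y).
Proof. by apply: eq_from_tnth => i; rewrite !tnth_mktuple. Qed.

End displaced_points.

Theorem proposition2p1 (R : realType) (p : R) (hp : 2 <= p) :
  exists2 C : R, 0 < C &
  forall (n k m : nat) (hk : (1 <= k <= n)%N)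
    (hm : Num.sqrt (n%:R / k%:R : R) <= m%:R)
    (f : n.-tuple R -> R[i]) (hf : torus_measurable f),
  (('C(n, k)%:R^-1)%:E *
   \sum_(S : {set 'I_n} | #|S| == k)
     \int[lebesgue_measure_tuple n]_(x in torus n)
     \int[lebesgue_measure_tuple n]_(y in torus n)
       (normc (f (torus_add x (tuple_restr S y)) - f x) `^ p)%:E
   <=
   (C * m%:R `^ p)%:E *
     \int[lebesgue_measure_tuple n]_(x in torus n)
     \int[lebesgue_measure_tuple n]_(y in torus n)
       (k%:R / n%:R *
          (\sum_(j < n)
             normc (f (torus_add x
                        (tuple_scale (4 * m%:R)^-1 (tuple_restr [set j] y)))
                    - f x) `^ p)
        + (k%:R / n%:R) `^ (p / 2) *
          normc (f (torus_add x (tuple_scale (4 * m%:R)^-1 y)) - f x)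
            `^ p)%:E)%E.
Proof.
have p1 : 1 <= p by lra.
have K0 := increment_const_gt0 hp.
(* [2^(p - 1)] splits the modulus into real and imaginary parts, and the factor 2 counts these
   parts, each of which is bounded by the complex right-hand side. *)
exists (2 `^ (p - 1) * (increment_const p * 2)).
  by apply: mulr_gt0; [exact: powR_gt0|exact: mulr_gt0].
move=> n k m hk hm f [mRe mIm].
have [N1 [mN1 N10 F1]] := lebesgue_measurable_off_null mRe.
have [N2 [mN2 N20 F2]] := lebesgue_measurable_off_null mIm.
pose N := N1 `|` N2.
have mN : measurable N by exact: measurableU.
have N0 : power_measure (@lebesgue_measure R) n N = 0%E by rewrite null_set_setU.
pose f1 := (fun x => complex.Re (f x)) \_ (torus n `\` N).
pose f2 := (fun x => complex.Im (f x)) \_ (torus n `\` N).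
have mf1 : measurable_fun setT f1 by apply: F1 => //; exact: subsetUl.
have mf2 : measurable_fun setT f2 by apply: F2 => //; exact: subsetUr.
have normcE v x y : torus n x -> ~ N x -> ~ N (displaced v (x, y)) ->
    normc (f (displaced v (x, y)) - f x) `^ p = complex_incr f1 f2 p v (x, y).
  move=> Tx Nx Nv; rewrite normc_powR /complex_incr /sumsq_powR.
  have Tv := displaced_torus v (x, y).
  rewrite /displ displaced0// /f1 /f2 !patchE !mem_set//.
  have ReB (u w : R[i]) : complex.Re (u - w) = complex.Re u - complex.Re w.
    by case: u w => ? ? [].
  have ImB (u w : R[i]) : complex.Im (u - w) = complex.Im u - complex.Im w.
    by case: u w => ? ? [].
  by rewrite ReB ImB.
pose q : R := k%:R / n%:R; have q0 : 0 <= q by rewrite divr_ge0.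
have LS (S : {set 'I_n}) :
    (\int[lebesgue_measure_tuple n]_(x in torus n)
     \int[lebesgue_measure_tuple n]_(y in torus n)
       (normc (f (torus_add x (tuple_restr S y)) - f x) `^ p)%:E)%E
    = torus_int (complex_incr f1 f2 p (ind S)).
  apply: (completed_torus_int mN N0 (v := fun _ : unit => ind S)).
  - exact: nnmeasurable_complex_incr.
  - by move=> x y; exact: powR_ge0.
  move=> x y Tx Ty Nx Nv; rewrite torus_add_restr.
  exact: normcE (Nv tt).
pose G z := q * (\sum_(j < n) complex_incr f1 f2 p (axis (4 * m%:R)^-1 j) z) +
  q `^ (p / 2) * complex_incr f1 f2 p (fun=> (4 * m%:R)^-1) z.
have mc v := nnmeasurable_complex_incr mf1 mf2 p v.
have mG : nnmeasurable G.
  apply: nnmeasurableD; apply: nnmeasurableZ => //; last exact: powR_ge0.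
  exact: nnmeasurable_sum.
have -> : (\int[lebesgue_measure_tuple n]_(x in torus n)
     \int[lebesgue_measure_tuple n]_(y in torus n)
       (k%:R / n%:R *
          (\sum_(j < n)
             normc (f (torus_add x
                        (tuple_scale (4 * m%:R)^-1 (tuple_restr [set j] y)))
                    - f x) `^ p)
        + (k%:R / n%:R) `^ (p / 2) *
          normc (f (torus_add x (tuple_scale (4 * m%:R)^-1 y)) - f x)
            `^ p)%:E)%E = torus_int G.
  (* The displacements to be kept off [N] are indexed by [option 'I_n]: one for each axis, and
     [None] for the full one. *)
  apply: (completed_torus_int mN N0
    (v := fun o : option 'I_n => if o is Some j
       then axis (4 * m%:R)^-1 j else fun=> (4 * m%:R)^-1)) => //.
    move=> x y; apply: addr_ge0; apply: mulr_ge0 => //; try exact: powR_ge0.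
    by apply: sumr_ge0 => j _; exact: powR_ge0.
  move=> x y Tx Ty Nx Nv; rewrite /G torus_add_scale; congr (_ * _ + _ * _).
    apply: eq_bigr => j _; rewrite torus_add_scale_axis.
    exact: normcE (Nv (Some j)).
  exact: normcE (Nv None).
under eq_bigr do rewrite LS.
have X1 := increments_Xp hp hk hm mf1.
have X2 := increments_Xp hp hk hm mf2.
have RE (g : n.-tuple (measurableTypeR R) -> R) : measurable_fun setT g ->
   (forall v z, `|displ g v z - displ g (fun=> 0) z| `^ p <= complex_incr f1 f2 p v z) ->
   ((k%:R / n%:R)%:E * (\sum_(j < n) increment g p (axis (4 * m%:R)^-1 j)%R (fun=> 0)%R)
      + ((k%:R / n%:R) `^ (p / 2))%:E * increment g p (fun=> (4 * m%:R)^-1)%R (fun=> 0)%R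
    <= torus_int G)%E.
  move=> mg hg; have mi v := nnmeasurable_increment mg p v (fun=> 0).
  rewrite /increment -torus_int_sum// -torus_intZ//; last exact: nnmeasurable_sum.
  rewrite -(torus_intZ (powR_ge0 _ _))// -torus_intD; last 2 first.
  - by apply: nnmeasurableZ => //; exact: nnmeasurable_sum.
  - by apply: nnmeasurableZ => //; exact: powR_ge0.
  apply: torus_int_le => //.
    apply: nnmeasurableD; apply: nnmeasurableZ; rewrite ?powR_ge0//.
    exact: nnmeasurable_sum.
  move=> z; apply: lerD; apply: ler_wpM2l => //; try exact: powR_ge0.
    by apply: ler_sum => j _; exact: hg.
  exact: hg.
have p0 : 0 <= p by lra.
have R1 := RE f1 mf1 (fun v z => le_sumsq_powR _ _ p0).
have hg2 v z : `|displ f2 v z - displ f2 (fun=> 0) z| `^ p <= complex_incr f1 f2 p v z.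
  by rewrite /complex_incr sumsq_powRC; exact: le_sumsq_powR.
have R2 := RE f2 mf2 hg2.
set A := (_ * torus_int G)%E.
pose c := increment_const p * m%:R `^ p.
have c0 : 0 <= c by rewrite mulr_ge0 ?powR_ge0 ?(ltW K0).
pose B (g : n.-tuple (measurableTypeR R) -> R) :=
  (('C(n, k)%:R^-1)%:E *
    \sum_(S : {set 'I_n} | #|S| == k) increment g p (ind S) (fun=> 0)%R)%E.
have c0' : (0 <= c%:E)%E by rewrite lee_fin.
have B1 : (B f1 <= c%:E * torus_int G)%E := le_trans X1 (lee_wpmul2l c0' R1).
have B2 : (B f2 <= c%:E * torus_int G)%E := le_trans X2 (lee_wpmul2l c0' R2).
have inc0 (g : n.-tuple (measurableTypeR R) -> R) (S : {set 'I_n}) :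
    measurable_fun setT g -> (0 <= increment g p (ind S) (fun=> 0)%R)%E.
  by move=> mg; exact: increment_ge0.
apply: (@le_trans _ _ ((2 `^ (p - 1))%:E * (B f1 + B f2))%E).
  rewrite /B -ge0_muleDr; last 2 first.
  - by apply: sume_ge0 => S _; exact: inc0.
  - by apply: sume_ge0 => S _; exact: inc0.
  rewrite muleCA; apply: lee_wpmul2l; first by rewrite lee_fin invr_ge0.
  rewrite -big_split /= ge0_sume_distrr; last first.
    by move=> S _; apply: adde_ge0; exact: inc0.
  by apply: lee_sum => S _; exact: complex_incr_le.
have b0 : (0 <= (2 `^ (p - 1))%:E :> \bar R)%E by rewrite lee_fin powR_ge0.
apply: le_trans (lee_wpmul2l b0 (leeD B1 B2)) _.
have G0 := torus_int_ge0 mG.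
rewrite -ge0_muleDl ?lee_fin// muleA -EFinD -EFinM /A.
by rewrite le_eqVlt; apply/orP; left; apply/eqP; congr (_%:E * _)%E; rewrite /c; ring.
Qed.
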